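(* Let $K$ be either $\mathbb{Q}_2(\sqrt{-1})$ or $\mathbb{Q}_2(\sqrt{-5})$. Then $\Gamma^*(6,K)=7$; that is, every equation $a_1x_1^6+\cdots+a_7x_7^6=0$ with $a_1,\dots,a_7\in K$ has a solution $(x_1,\dots,x_7)\in K^7\setminus\{0\}$, and there exist $a_1,\dots,a_6\in K$ such that $a_1x_1^6+\cdots+a_6x_6^6=0$ has no solution in $K^6\setminus\{0\}$.
   Context: For a field $K$ that is a finite extension of $\mathbb{Q}_p$ and a positive integer $d$, $\Gamma^*(d,K)$ denotes the least positive integer $s$ such that for every choice of coefficients $a_1,\dots,a_s\in K$ the equation $a_1x_1^d+\cdots+a_sx_s^d=0$ has a nontrivial solution (one with $(x_1,\dots,x_s)\neq 0$) in $K^s$. *)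

(* Defs.v *)
From HB Require Import structures.
From mathcomp Require Import all_boot all_order all_algebra all_field.
From mathcomp Require Import boolp zify.

Set Implicit Arguments.
Unset Strict Implicit.
Unset Printing Implicit Defensive.

Import Order.TTheory GRing.Theory Num.Theory.

Local Open Scope ring_scope.

(* Z_p as the inverse limit of the rings Z/p^n. The n-th component of a p-adic
   integer is the canonical representative, in [0, p^n), of its class mod p^n:
   the coherence condition also forces the range. The primality proof is a
   parameter so that the ring instances can be attached to the type. *)
Record padic_int (p : nat) (p_pr : prime p) := PadicInt {
  residue :> nat -> int;
  residue_coh : forall n, (residue n.+1 %% (p ^ n)%N)%Z = residue n
}.

Section PadicInt.
Variables (p : nat) (p_pr : prime p).
Local Notation Zp := (padic_int p_pr).
Implicit Types x y z : Zp.

HB.instance Definition _ := gen_eqMixin Zp.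
HB.instance Definition _ := gen_choiceMixin Zp.

Lemma padic_int_inj x y : (forall n, x n = y n) -> x = y.
Proof.
case: x y => [f fP] [g gP] /= /funext E; case: g / E gP => gP.
by rewrite (Prop_irrelevance fP gP).
Qed.

Lemma residue_mod x n : (x n %% (p ^ n)%N)%Z = x n.
Proof. by rewrite -(residue_coh x n) modz_mod. Qed.

Lemma residue_coh_le x m n : (m <= n)%N -> (x n %% (p ^ m)%N)%Z = x m.
Proof.
move=> le_mn; rewrite -(subnK le_mn); elim: (n - m)%N => [|k IHk].
  by rewrite add0n residue_mod.
rewrite -{}IHk addSn -(residue_coh x (k + m)).
apply/eqP; rewrite eqz_mod_dvd.
set d := ((p ^ (k + m))%N : int); set a := x _.
have dvd_d : ((p ^ m)%N %| d)%Z by rewrite dvdzE /= dvdn_exp2l // leq_addl.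
apply: (dvdz_trans dvd_d).
by rewrite -eqz_mod_dvd modz_mod.
Qed.

Definition coherent (f : nat -> int) :=
  forall n, (f n.+1 = f n %[mod (p ^ n)%N])%Z.

Lemma mk_padic_subproof f : coherent f ->
  forall n, ((f n.+1 %% (p ^ n.+1)%N)%Z %% (p ^ n)%N)%Z
              = (f n %% (p ^ n)%N)%Z.
Proof.
move=> fP n; rewrite -[RHS]fP.
apply/eqP; rewrite eqz_mod_dvd.
apply: (@dvdz_trans (p ^ n.+1)%N); first by rewrite dvdzE /= dvdn_exp2l.
by rewrite -eqz_mod_dvd modz_mod.
Qed.

Definition mk_padic f (fP : coherent f) : Zp :=
  PadicInt p_pr (mk_padic_subproof fP).

Lemma padic_const_subproof (a : int) : coherent (fun=> a).
Proof. by []. Qed.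

Lemma padic_add_subproof x y : coherent (fun n => x n + y n).
Proof. by move=> n; rewrite -modzDm !residue_coh. Qed.

Lemma padic_opp_subproof x : coherent (fun n => - x n).
Proof. by move=> n; rewrite -modzNm residue_coh. Qed.

Lemma padic_mul_subproof x y : coherent (fun n => x n * y n).
Proof. by move=> n; rewrite -modzMm !residue_coh. Qed.

Definition padic_zero := mk_padic (padic_const_subproof 0).
Definition padic_one := mk_padic (padic_const_subproof 1).
Definition padic_add x y := mk_padic (@padic_add_subproof x y).
Definition padic_opp x := mk_padic (@padic_opp_subproof x).
Definition padic_mul x y := mk_padic (@padic_mul_subproof x y).

Lemma padic_addA : associative padic_add.
Proof.
by move=> x y z; apply: padic_int_inj => n /=; rewrite modzDmr modzDml addrA.
Qed.

Lemma padic_addC : commutative padic_add.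
Proof. by move=> x y; apply: padic_int_inj => n /=; rewrite addrC. Qed.

Lemma padic_add0 : left_id padic_zero padic_add.
Proof.
by move=> x; apply: padic_int_inj => n /=; rewrite modzDml add0r residue_mod.
Qed.

Lemma padic_addN : left_inverse padic_zero padic_opp padic_add.
Proof.
by move=> x; apply: padic_int_inj => n /=; rewrite modzDml addNr.
Qed.

HB.instance Definition _ :=
  GRing.isZmodule.Build Zp padic_addA padic_addC padic_add0 padic_addN.

Lemma padic_mulA : associative padic_mul.
Proof.
by move=> x y z; apply: padic_int_inj => n /=; rewrite modzMmr modzMml mulrA.
Qed.

Lemma padic_mulC : commutative padic_mul.
Proof. by move=> x y; apply: padic_int_inj => n /=; rewrite mulrC. Qed.

Lemma padic_mul1 : left_id padic_one padic_mul.
Proof.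
by move=> x; apply: padic_int_inj => n /=; rewrite modzMml mul1r residue_mod.
Qed.

Lemma padic_mulDl : left_distributive padic_mul padic_add.
Proof.
by move=> x y z; apply: padic_int_inj => n /=; rewrite modzMml modzDm mulrDl.
Qed.

Lemma padic_one_neq0 : padic_one != 0.
Proof.
apply/eqP => /(congr1 (fun x : Zp => x 1%N)) /=.
have p_gt1 := prime_gt1 p_pr.
by rewrite expn1 !modz_nat mod0n modn_small.
Qed.

HB.instance Definition _ := GRing.Zmodule_isComNzRing.Build Zp
  padic_mulA padic_mulC padic_mul1 padic_mulDl padic_one_neq0.

Lemma residue0 n : (0 : Zp) n = 0.
Proof. by rewrite /= mod0z. Qed.

Lemma residue1 n : (1 : Zp) n = (1 %% (p ^ n)%N)%Z.
Proof. by []. Qed.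

Lemma residueD x y n : (x + y) n = ((x n + y n) %% (p ^ n)%N)%Z.
Proof. by []. Qed.

Lemma residueN x n : (- x) n = ((- x n) %% (p ^ n)%N)%Z.
Proof. by []. Qed.

Lemma residueM x y n : (x * y) n = ((x n * y n) %% (p ^ n)%N)%Z.
Proof. by []. Qed.

Definition padic_unit : {pred Zp} := fun x => `[< exists y, y * x = 1 >].

Definition padic_inv x : Zp :=
  if pselect (exists y, y * x = 1) is left x_unit then projT1 (cid x_unit)
  else x.

Lemma padic_mulVx : {in padic_unit, left_inverse 1 padic_inv *%R}.
Proof.
move=> x /asboolP x_unit; rewrite /padic_inv.
by case: pselect => // x_unit'; case: cid.
Qed.

Lemma padic_unitPl x y : y * x = 1 -> padic_unit x.
Proof. by move=> yx1; apply/asboolP; exists y. Qed.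

Lemma padic_inv_out : {in [predC padic_unit], padic_inv =1 id}.
Proof.
move=> x; rewrite inE => /asboolPn x_nunit; rewrite /padic_inv.
by case: pselect.
Qed.

HB.instance Definition _ := GRing.ComNzRing_hasMulInverse.Build Zp
  padic_mulVx padic_unitPl padic_inv_out.

Lemma prime_exp_dvdM m n (a b : nat) :
  (p ^ (m + n) %| a * b)%N -> (p ^ m %| a)%N || (p ^ n %| b)%N.
Proof.
have [-> | a_gt0] := posnP a; first by rewrite dvdn0.
have [-> | b_gt0] := posnP b; first by rewrite dvdn0 orbT.
rewrite !pfactor_dvdn ?muln_gt0 ?a_gt0 // lognM // => le_mn.
by apply: contraLR le_mn; rewrite negb_or -!ltnNge => /andP[]; lia.
Qed.

Lemma padic_int_domain x y : x * y = 0 -> (x == 0) || (y == 0).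
Proof.
move=> xy0; apply/norP => -[x_neq0 y_neq0].
have res_neq0 (u : Zp) : u != 0 -> exists n, u n != 0.
  move=> u_neq0; apply: contrapT => u0; case/eqP: u_neq0.
  apply: padic_int_inj => n; rewrite residue0; apply/eqP/negPn/negP => un.
  by apply: u0; exists n.
have [m xm] := res_neq0 x x_neq0; have [n yn] := res_neq0 y y_neq0.
have: (x (m + n)%N * y (m + n)%N %% (p ^ (m + n))%N)%Z = 0.
  by rewrite -residueM xy0 residue0.
move/dvdz_mod0P; rewrite dvdzE abszM => /prime_exp_dvdM /orP[] dv.
  case/eqP: xm; rewrite -(residue_coh_le x (leq_addr n m)).
  by apply/dvdz_mod0P; rewrite dvdzE.
case/eqP: yn; rewrite -(residue_coh_le y (leq_addl m n)).
by apply/dvdz_mod0P; rewrite dvdzE.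
Qed.

HB.instance Definition _ :=
  GRing.ComUnitRing_isIntegral.Build Zp padic_int_domain.

End PadicInt.

Arguments padic_int {p} p_pr.

Definition padic (p : nat) (p_pr : prime p) := {fraction padic_int p_pr}.
HB.instance Definition _ p p_pr := GRing.Field.on (@padic p p_pr).

Notation Q2 := (@padic 2 isT).

(* The extension L is F(sqrt a), with t a square root of a. *)
Definition adjoins_sqrt (F : fieldType) (a : F) (L : fieldExtType F) (t : L) :=
  t ^+ 2 = a%:A /\ <<1%VS; t>>%VS = fullv.

Lemma adjoins_sqrt_exists (F : fieldType) (a : F) :
  exists (L : fieldExtType F) (t : L), adjoins_sqrt a t.
Proof.
have sz : size ('X^2 - a%:P : {poly F}) = 3 by rewrite size_XnsubC.
have [[r r2] | no_root] := pselect (exists r : F, r ^+ 2 = a).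
  exists (F^o : fieldExtType F), r; split.
    by rewrite r2 /GRing.scale /= mulr1.
  by apply/eqP; rewrite eqEsubv subvf regular_fullv subv_adjoin.
have irr : irreducible_poly ('X^2 - a%:P : {poly F}).
  apply: cubic_irreducible; first by rewrite sz.
  move=> r; apply/negP; rewrite /root !hornerE subr_eq0 => /eqP r2.
  by apply: no_root; exists r.
have [L _ [t rt genL]] := irredp_FAdjoin irr.
exists L, t; split=> //; apply/eqP; move: rt.
by rewrite rmorphB /= map_polyXn map_polyC /root !hornerE subr_eq0.
Qed.

Definition diagonal_solvable (d s : nat) (K : fieldType) : Prop :=
  forall a : 'rV[K]_s,
    exists2 x : 'rV[K]_s, x != 0 & \sum_(i < s) a 0 i * x 0 i ^+ d = 0.

Definition Gamma_star_bound (d : nat) (K : fieldType) : pred nat :=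
  fun s => (0 < s)%N && `[< diagonal_solvable d s K >].

(* The value 0 stands for the absence of any admissible s. *)
Definition Gamma_star (d : nat) (K : fieldType) : nat :=
  if pselect (exists s, Gamma_star_bound d K s) is left ex_s then ex_minn ex_s
  else 0%N.

Lemma Gamma_starP (d : nat) (K : fieldType) (s : nat) : (0 < s)%N ->
  Gamma_star d K = s <->
  diagonal_solvable d s K /\
  (forall r, (0 < r)%N -> diagonal_solvable d r K -> (s <= r)%N).
Proof.
move=> s_gt0; rewrite /Gamma_star; case: pselect => [ex_s | no_s]; last first.
  split=> [s0 | [solv _]]; first by rewrite -s0 in s_gt0.
  by case: no_s; exists s; apply/andP; split=> //; apply/asboolP.
case: ex_minnP => m /andP[m_gt0 /asboolP solv_m] min_m.
split=> [<- | [solv_s min_s]].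
  split=> // r r_gt0 solv_r; apply: min_m.
  by apply/andP; split=> //; apply/asboolP.
apply/eqP; rewrite eqn_leq min_s // andbT; apply: min_m.
by apply/andP; split=> //; apply/asboolP.
Qed.

(* Main.v *)
(* K is totally ramified over Q_2 with residue field F_2, so every unit is a cube
   and the sixth powers are the elements w^(6k) u^2, w a uniformizer, u a unit.
   By Hensel's lemma 1 + w^5 O consists of sixth powers, and the classes
   of K^* modulo sixth powers are the 48 classes of w^k r, where k < 6 and r runs
   through 8 units.

   Lower bound: in
     x1^6 + w (x2^6 + t x3^6) + w^3 (x4^6 + t x5^6) + w^5 x6^6
   the four parts have valuations 0, {1, 2}, {3, 4} and 5 modulo 6, so they cannot
   cancel.

   Upper bound: by induction on the number of variables, one computes sets of
   classes represented by an anisotropic diagonal form; a form a :: s is isotropic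
   as soon as s represents the class of -a. Starting from <1, r> with r a unit (two
   of seven coefficients have the same valuation modulo 6), no anisotropic form
   survives five further steps. *)

Require Import Defs.
From HB Require Import structures.
From Stdlib Require Import ZArith MSetPositive.
From mathcomp Require Import all_boot all_order all_algebra all_field.
From mathcomp Require Import boolp ssrZ zify ring.

Set Implicit Arguments.
Unset Strict Implicit.
Unset Printing Implicit Defensive.

Import Order.TTheory GRing.Theory Num.Theory.

Local Open Scope ring_scope.

(** * p-adic integers *)

Section PadicDivisibility.
Variables (p : nat) (p_pr : prime p).
Local Notation Zp := (padic_int p_pr).
Implicit Types x y : Zp.

Lemma residue_int (z : int) n : (z%:~R : Zp) n = (z %% (p ^ n)%N)%Z.
Proof.
have nat_case (m : nat) : (m%:R : Zp) n = (m %% (p ^ n)%N)%Z.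
  elim: m => [|m IHm]; first by rewrite residue0 mod0z.
  by rewrite mulrS residueD residue1 IHm modzDm -intS.
case: z => m; first by rewrite -pmulrn nat_case.
by rewrite NegzE mulrNz residueN -pmulrn nat_case modzNm.
Qed.

Lemma residue_eq0P x n :
  reflect (exists y, x = (p ^ n)%:R * y) (x n == 0).
Proof.
apply: (iffP eqP) => [xn0 | [y ->]]; last first.
  by rewrite residueM pmulrn residue_int modzz mul0r mod0z.
have dvd_pn k : ((p ^ n)%N %| x (n + k)%N)%Z.
  by apply/dvdz_mod0P; rewrite residue_coh_le ?leq_addr.
have p_neq0 k : ((p ^ k)%N : int) != 0.
  by rewrite eqz_nat -lt0n expn_gt0 prime_gt0.
(* The residue of order k of the quotient is the residue of order n + k of [x], divided exactly by
   p^n. *)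
have coh : coherent p (fun k => (x (n + k)%N %/ (p ^ n)%N)%Z).
  move=> k; apply/eqP; rewrite eqz_mod_dvd -(dvdz_mul2r (p_neq0 n)).
  rewrite mulrBl !divzK // -PoszM -expnD -eqz_mod_dvd.
  by rewrite addnS (addnC k) residue_coh residue_mod.
exists (mk_padic p_pr coh); apply: padic_int_inj => k.
rewrite residueM /= pmulrn residue_int modzMm mulrC divzK //.
by rewrite residue_coh_le // leq_addl.
Qed.

Lemma padic_int_digits x n : exists y, x = (x n)%:~R + (p ^ n)%:R * y.
Proof.
have /residue_eq0P[y Dy] : (x - (x n)%:~R) n == 0.
  rewrite residueD residueN residue_int residue_mod.
  by rewrite modzDmr subrr mod0z.
by exists y; rewrite -Dy addrC subrK.
Qed.

Lemma padic_int_separated x : (forall n, exists y, x = (p ^ n)%:R * y) -> x = 0.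
Proof.
move=> x_div; apply: padic_int_inj => n.
by rewrite residue0; apply/eqP/residue_eq0P.
Qed.

Lemma padic_int_complete (f : nat -> Zp) :
    (forall n, exists y, f n.+1 - f n = (p ^ n)%:R * y) ->
  exists l, forall n, exists y, l - f n = (p ^ n)%:R * y.
Proof.
move=> f_cauchy.
have resB x y n : reflect (x n = y n) ((x - y) n == 0).
  rewrite residueD residueN modzDmr; apply: (iffP eqP) => [|->]; last first.
    by rewrite subrr mod0z.
  by move=> /dvdz_mod0P; rewrite -eqz_mod_dvd !residue_mod => /eqP.
have f_res n : f n.+1 n = f n n by apply/resB/residue_eq0P.
(* From index n on, [f] is constant modulo p^n, so the diagonal residues define the limit. *)
have coh : coherent p (fun n => f n n).
  by move=> n; rewrite residue_coh residue_mod f_res.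
exists (mk_padic p_pr coh) => n.
by apply/residue_eq0P/resB; rewrite /= residue_mod.
Qed.

End PadicDivisibility.

Local Notation Z2 := (@padic_int 2 isT).

Lemma dyadic_parity (x : Z2) : exists b : bool, exists y, x = b%:R + 2%:R * y.
Proof.
have [y Dy] := padic_int_digits x 1; have := residue_mod x 1.
have := modz_ge0 (x 1%N) (isT : (2 : int) != 0).
have := ltz_pmod (x 1%N) (isT : (0 : int) < 2).
case: (_ %% _)%Z => [[|[|//]]|//] _ _ x1; rewrite -x1 in Dy.
- by exists false, y.
- by exists true, y.
Qed.

Lemma dyadic_one_neq_double (x : Z2) : 1 <> 2%:R * x.
Proof.
by move=> Dx; have /residue_eq0P: exists y, 1 = (2 ^ 1)%:R * y :> Z2 by exists x.
Qed.

(* -1/3 = 1 + 4 + 4^2 + ... *)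
Lemma dyadic_inv3 : exists x : Z2, 3%:R * x = 1.
Proof.
have sumE n : 3%:R * (\sum_(i < n) 4%:R ^+ i) = 4%:R ^+ n - 1 :> Z2.
  elim: n => [|n IHn]; first by rewrite big_ord0 mulr0 subrr.
  by rewrite big_ord_recr /= mulrDr IHn exprS; ring.
have [|l Dl] := @padic_int_complete 2 isT (fun n => \sum_(i < n) 4%:R ^+ i).
  move=> n; rewrite big_ord_recr /= addrAC subrr add0r; exists (2 ^ n)%:R.
  by rewrite -natrM -expnMn -natrX.
exists (- l); apply/eqP; rewrite -subr_eq0; apply/eqP/padic_int_separated => n.
have [y Dy] := Dl n; exists (- (3%:R * y) - 2%:R ^+ n).
have -> : 3%:R * - l - 1 = - (3%:R * (l - \sum_(i < n) 4%:R ^+ i))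
                           - 3%:R * (\sum_(i < n) 4%:R ^+ i) - 1 by ring.
by rewrite Dy sumE (natrX _ 2 n) -[4%N]/(2 * 2)%N natrM exprMn; ring.
Qed.

(** * The finite computation *)

Section ClassComputation.
Local Open Scope Z_scope.

(* false stands for t ^ 2 = -1 and true for t ^ 2 = -5. *)
Variable e : bool.

(** This is $-t^2$; a pair (m, n) of integers stands for m + n t. *)
Definition quad_norm : Z := if e then 5 else 1.
Local Notation d := quad_norm.

Definition quad_mul (a b : Z * Z) : Z * Z :=
  (a.1 * b.1 - d * (a.2 * b.2), a.1 * b.2 + a.2 * b.1).

Definition quad_add (a b : Z * Z) : Z * Z := (a.1 + b.1, a.2 + b.2).

Definition quad_exp6 (a : Z * Z) : Z * Z :=
  let b := quad_mul a a in quad_mul b (quad_mul b b).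

(** Each unit agrees with one of these up to a sixth power; [unit_table_correct] checks it on
    coordinates modulo 8. *)
Definition unit_reps : seq (Z * Z) :=
  [:: (1, 0); (5, 0); (1, 2); (5, 2); (0, 1); (2, 1); (4, 1); (6, 1)].

(** A criterion in coordinates for m + n t to lie in 1 + P^5, where P is the maximal ideal. *)
Definition one_mod5 (a : Z * Z) :=
  [&& Z.eqb ((a.1 - 1) mod 4) 0, Z.eqb (a.2 mod 4) 0
    & Z.eqb ((a.1 - 1 + a.2) mod 8) 0].

(** Since a / b = a b^5 / b^6, it suffices that a b^5 or a b^5 t^6 lies in 1 + P^5, whose elements
    are all sixth powers. *)
Definition same_unit_class (a b : Z * Z) :=
  let c := quad_mul a (quad_mul b (quad_mul (quad_mul b b) (quad_mul b b))) in
  one_mod5 c || one_mod5 (quad_mul c (quad_exp6 (0, 1))).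

Definition residues8 : seq Z := [:: 0; 1; 2; 3; 4; 5; 6; 7].

(** Coordinates modulo 8 determine a unit modulo P^5, because 8 has valuation 6. An entry is
    meaningful when m + n is odd. *)
Definition unit_table : seq (seq nat) :=
  [seq [seq find (same_unit_class (m, n)) unit_reps | n <- residues8]
     | m <- residues8].

Definition unit_index (tab : seq (seq nat)) m n : nat :=
  nth 0%N (nth [::] tab (Z.to_nat (Z.land m 7))) (Z.to_nat (Z.land n 7)).

(* Multiplication by theta = (1 - t) / 2 lowers the valuation by 1; the class of
   theta ^ (- k) r_j, with r_j the j-th unit representative, is 8 * (k mod 6) + j.
   The integers m and n are the coordinates of m + n t. *)
Fixpoint class_index tab fuel (k : nat) (m n : Z) : option nat :=
  if fuel is f.+1 then
    if Z.odd (m + n) then Some (8 * k + unit_index tab m n)%N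
    else class_index tab f (if k is 5%N then 0%N else k.+1)
           (Z.div2 (m + d * n)) (Z.div2 (n - m))
  else None.

(** Running out of fuel gives [None], which can lose a class but cannot produce a wrong one. *)
Definition class_of tab a := class_index tab 60 0%N a.1 a.2.

(** The uniformizer theta^(-1) is replaced by 1 + t, which has integer coordinates and differs from
    it by a factor 1 or, when t^2 = -5, by 3, a sixth power there. *)
Definition class_rep (l : nat) : Z * Z :=
  iter (l %/ 8) (quad_mul (1, 1)) (nth (1, 0) unit_reps (l %% 8)).

(* A positive number is read as the list of its binary digits, the lowest one
   first, without the leading 1; it stands for a set of indices. *)
Fixpoint set_mem (p : positive) (i : nat) : bool :=
  match p, i with
  | xH, _ => false
  | xI _, 0%N => true
  | xO _, 0%N => false
  | xI q, j.+1 | xO q, j.+1 => set_mem q j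
  end.

Fixpoint set_empty (n : nat) : positive :=
  if n is m.+1 then xO (set_empty m) else xH.

Fixpoint set_insert (i : nat) (p : positive) : positive :=
  match i, p with
  | _, xH => xH
  | 0%N, xI q | 0%N, xO q => xI q
  | j.+1, xI q => xI (set_insert j q)
  | j.+1, xO q => xO (set_insert j q)
  end.

Fixpoint set_union (p q : positive) : positive :=
  match p, q with
  | xH, _ => q
  | _, xH => p
  | xO p', xO q' => xO (set_union p' q')
  | xO p', xI q' | xI p', xO q' | xI p', xI q' => xI (set_union p' q')
  end.

Fixpoint set_bigunion (p : positive) (s : seq positive) acc : positive :=
  match p, s with
  | xI q, x :: s' => set_bigunion q s' (set_union acc x)
  | xO q, _ :: s' => set_bigunion q s' acc
  | _, _ => acc
  end.

Definition set_of (s : seq nat) : positive :=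
  foldl (fun p i => set_insert i p) (set_empty 48) s.

(* The pairs (X, Y) to be tried in g X ^ 6 + h Y ^ 6, where g and h have valuations
   k and l. Any list would be sound; this one is long enough for the final check. *)
Definition trials (k l : nat) : seq ((Z * Z) * (Z * Z)) :=
  if k == l then
    [seq ((1, 0), (m, n)) | m <- residues8, n <- [seq n <- residues8 | Z.odd (m + n)]]
  else if (k < l)%N then
    [:: ((1, 0), (1, 0)); ((1, 0), (0, 1)); ((1, 1), (1, 0)); ((1, 1), (0, 1))]
  else
    [:: ((1, 0), (1, 0)); ((1, 0), (0, 1));
        ((1, 0), (1, 1)); ((1, 0), quad_mul (1, 1) (0, 1))].

Definition trial_powers k l :=
  [seq (quad_exp6 p.1, quad_exp6 p.2) | p <- trials k l].

Definition represented tab tr (g h : Z * Z) : seq nat :=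
  pmap (fun p => class_of tab (quad_add (quad_mul g p.1) (quad_mul h p.2))) tr.

Definition class_reps := [seq (l, class_rep l) | l <- iota 0 48].

(* For g_l = h.2 with l = h.1: the class of -g_l, the set {l}, and for each k the
   set of the classes represented by g_k X ^ 6 + g_l Y ^ 6. *)
Definition step_row tab eqs lts gts reps (h : nat * (Z * Z)) :
    nat * (positive * seq positive) :=
  (odflt 0%N (class_of tab (quad_mul (-1, 0) h.2)),
   (set_of [:: h.1],
    [seq let k := (g.1 %/ 8)%N in let l := (h.1 %/ 8)%N in
         set_of (g.1 :: h.1 :: represented tab
           (if k == l then eqs else if (k < l)%N then lts else gts) g.2 h.2)
       | g <- reps])).

(** The trial pairs depend on the two valuations only through their comparison, so three lists serve
    all rows. *)
Definition step_table :=
  let tab := unit_table in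
  let reps := class_reps in
  let eqs := trial_powers 0 0 in
  let lts := trial_powers 0 1 in
  let gts := trial_powers 1 0 in
  [seq step_row tab eqs lts gts reps h | h <- reps].

(** Each [D] in [S] consists of classes represented by some form. A row whose class of -g_l lies in
    [D] makes the longer form isotropic and is dropped; each other row yields a set for the longer
    form. *)
Definition extend_sets (rows : seq (nat * (positive * seq positive)))
    (S : PositiveSet.t) : PositiveSet.t :=
  foldr PositiveSet.add PositiveSet.empty
    (flatten [seq [seq set_bigunion D r.2.2 r.2.1
                     | r <- [seq r <- rows | ~~ set_mem D r.1]]
                | D <- PositiveSet.elements S]).

End ClassComputation.

(* Among seven elements, two have the same valuation modulo 6; scaling makes them
   1 and a unit. Then five more steps leave no set of represented classes. *)
Lemma extend_sets_dies e :
  PositiveSet.is_empty (iter 5 (extend_sets (step_table e))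
    (extend_sets (take 8 (step_table e)) (PositiveSet.singleton (set_of [:: 0%N])))).
Proof. by case: e; vm_cast_no_check (erefl true). Qed.

(** * Soundness of the set operations *)

Fact positive_eqP : Equality.axiom Pos.eqb.
Proof. by move=> x y; apply: (iffP idP) => /Pos.eqb_eq. Qed.
HB.instance Definition _ := hasDecEq.Build positive positive_eqP.

Lemma set_mem_empty n i : set_mem (set_empty n) i = false.
Proof. by elim: n i => [|n IHn] [|i] /=. Qed.

Lemma set_mem_insert i p j : set_mem (set_insert i p) j -> j = i \/ set_mem p j.
Proof.
elim: p i j => [p IHp | p IHp | ] [|i] [|j] //=; try by [left | right].
  by case/IHp=> [-> | ]; [left | right].
by case/IHp=> [-> | ]; [left | right].
Qed.

Lemma set_mem_of s i : set_mem (set_of s) i -> i \in s.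
Proof.
suff mem_foldl p : set_mem (foldl (fun q j => set_insert j q) p s) i ->
    set_mem p i \/ i \in s.
  by case/mem_foldl; rewrite ?set_mem_empty.
elim: s p => [|j s IHs] p /=; first by left.
case/IHs=> [/set_mem_insert[-> | p_i] | s_i]; rewrite in_cons ?eqxx ?s_i ?orbT.
- by right.
- by left.
by right.
Qed.

Lemma set_mem_union p q i :
  set_mem (set_union p q) i -> set_mem p i \/ set_mem q i.
Proof.
elim: p q i => [p IHp|p IHp|] [q|q|] [|i] //=; try by [left | right | apply: IHp].
Qed.

Lemma set_mem_bigunion p s acc i : set_mem (set_bigunion p s acc) i ->
  set_mem acc i \/ exists2 k, set_mem p k & set_mem (nth xH s k) i.
Proof.
elim: p s acc => [p IHp|p IHp|] [|x s] acc /=; try by left.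
- case/IHp=> [/set_mem_union[] | [k pk sk]]; [by left | |].
    by right; exists 0%N.
  by right; exists k.+1.
- by case/IHp=> [|[k pk sk]]; [left | right; exists k.+1].
Qed.

Lemma extend_sets_correct (rows : seq (nat * (positive * seq positive))) S D r :
    PositiveSet.In D S -> r \in rows -> ~~ set_mem D r.1 ->
  PositiveSet.In (set_bigunion D r.2.2 r.2.1) (extend_sets rows S).
Proof.
move=> S_D rows_r D_r; rewrite /extend_sets.
have foldr_add (x : positive) s : x \in s ->
    PositiveSet.In x (foldr PositiveSet.add PositiveSet.empty s).
  elim: s => //= y s IHs; rewrite in_cons PositiveSet.add_spec.
  by case/orP=> [/eqP-> | /IHs]; [left | right].
apply: foldr_add; apply/flattenP.
have elts_D : D \in PositiveSet.elements S.
  have := (PositiveSet.elements_spec1 S D).2 S_D.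
  elim=> {S_D}[y s -> | y s _ IHs]; first by rewrite mem_head.
  by rewrite in_cons IHs orbT.
eexists; first by apply: map_f elts_D.
by apply: map_f; rewrite mem_filter D_r.
Qed.

(** * The ring of integers and its maximal ideal *)

Lemma fraction_denominator (R : idomainType) (q : {fraction R}) :
  exists a b : R, b != 0 /\ q * tofrac b = tofrac a.
Proof.
elim/quotW: q => x; exists \n_x, \d_x; split; first exact: denom_ratioP.
unlock tofrac; rewrite -[_ * _]FracField.pi_mul; apply/eqmodP.
rewrite /= FracField.equivfE /FracField.mulf.
by rewrite !numden_Ratio ?mulf_neq0 ?oner_neq0 ?denom_ratioP //= !mulr1 mulrC.
Qed.

Lemma dyadic_nat_neq0 n : (n.+1%:R : Z2) != 0.
Proof.
apply/eqP => /(congr1 (fun x : Z2 => x n.+1)).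
by rewrite residue0 pmulrn residue_int modz_nat modn_small // ltn_expl.
Qed.

Section QuadraticExtension.
(** Both fields are treated at once: t^2 is -1 or -5 according to [e]. The map [iota] embeds Z_2,
    and [iota_frac] says that 1 and [t] span K over the fractions of its image. *)
Variables (K : fieldType) (iota : {rmorphism Z2 -> K}) (t : K) (e : bool).
Hypothesis iota_inj : injective iota.
Hypothesis t_sqr : t ^+ 2 = - (1 + 4%:R * e%:R).
Hypothesis iota_frac :
  forall x, exists a b c, c != 0 /\ x * iota c = iota a + iota b * t.

Let iotaD x y : iota (x + y) = iota x + iota y. Proof. exact: raddfD. Qed.
Let iotaN x : iota (- x) = - iota x. Proof. exact: raddfN. Qed.
Let iotaB x y : iota (x - y) = iota x - iota y. Proof. exact: raddfB. Qed.
Let iotaX x n : iota (x ^+ n) = iota x ^+ n. Proof. exact: rmorphXn. Qed.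
Let iotaM x y : iota (x * y) = iota x * iota y. Proof. exact: rmorphM. Qed.
Let iota0 : iota 0 = 0. Proof. exact: raddf0. Qed.
Let iota1 : iota 1 = 1. Proof. exact: rmorph1. Qed.
Let iota_nat n : iota n%:R = n%:R. Proof. exact: rmorph_nat. Qed.
Let iota_int (n : int) : iota n%:~R = n%:~R. Proof. exact: rmorph_int. Qed.
Let iota_norm : iota (1 + 4%:R * e%:R) = 1 + 4%:R * e%:R.
Proof.
by rewrite (iotaD 1) (iotaM 4%:R) iota1 (iota_nat 4) (iota_nat e).
Qed.

Lemma natK_neq0 n : (n.+1%:R : K) != 0.
Proof.
rewrite -(iota_nat n.+1) -iota0 (inj_eq iota_inj).
exact: dyadic_nat_neq0.
Qed.

(** As -1 and -5 are congruent to 3 modulo 4, Z_2[t] is the full ring of integers. *)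
Definition integral : {pred K} :=
  fun x => `[< exists a b, x = iota a + iota b * t >].

Lemma integralP x :
  reflect (exists a b, x = iota a + iota b * t) (x \in integral).
Proof. exact: asboolP. Qed.

Fact integral_subring : subring_closed integral.
Proof.
split; first by apply/integralP; exists 1, 0; rewrite iota1 iota0; ring.
  move=> _ _ /integralP[a [b ->]] /integralP[a' [b' ->]].
  by apply/integralP; exists (a - a'), (b - b'); rewrite !iotaB; ring.
move=> _ _ /integralP[a [b ->]] /integralP[a' [b' ->]]; apply/integralP.
exists (a * a' - b * b' * (1 + 4%:R * e%:R)), (a * b' + a' * b).
have -> : (iota a + iota b * t) * (iota a' + iota b' * t)
  = iota a * iota a' + iota b * iota b' * t ^+ 2
    + (iota a * iota b' + iota a' * iota b) * t by ring.
rewrite t_sqr -iota_norm; move: (1 + _) => c.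
by rewrite iotaB iotaD !iotaM; ring.
Qed.
HB.instance Definition _ := GRing.isSubringClosed.Build K integral integral_subring.

Lemma iota_integral a : iota a \in integral.
Proof. by apply/integralP; exists a, 0; rewrite iota0; ring. Qed.

Lemma t_integral : t \in integral.
Proof. by apply/integralP; exists 0, 1; rewrite iota0 iota1; ring. Qed.

(** Modulo 4 the form is a^2 + b^2, which is 1 or 2 unless a and b are both even. *)
Lemma dyadic_norm_descent (a b : Z2) :
    a ^+ 2 + (1 + 4%:R * e%:R) * b ^+ 2 = 0 ->
  exists a' b', [/\ a = 2%:R * a', b = 2%:R * b'
                  & a' ^+ 2 + (1 + 4%:R * e%:R) * b' ^+ 2 = 0].
Proof.
have [x [a' ->]] := dyadic_parity a; have [y [b' ->]] := dyadic_parity b.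
set c := e%:R : Z2.
case: x y => [] [] E; last first.
- exists a', b'; split; rewrite ?add0r //.
  have: 4%:R * (a' ^+ 2 + (1 + 4%:R * c) * b' ^+ 2) = 0 by rewrite -[RHS]E /=; ring.
  by move/eqP; rewrite mulf_eq0 (negPf (dyadic_nat_neq0 3)) => /eqP.
- case: (@dyadic_one_neq_double (- (2%:R * (a' ^+ 2 + b' + b' ^+ 2
                                  + c * (1 + 2%:R * b') ^+ 2)))).
  by apply/eqP; rewrite -subr_eq0 -E /=; apply/eqP; ring.
- case: (@dyadic_one_neq_double (- (2%:R * (a' + a' ^+ 2
                                  + (1 + 4%:R * c) * b' ^+ 2)))).
  by apply/eqP; rewrite -subr_eq0 -E /=; apply/eqP; ring.
- have odd_neq0 (u v : Z2) : u = 0 -> u = 1 - 2%:R * v -> False.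
    by move=> -> /esym/eqP; rewrite subr_eq0 => /eqP/dyadic_one_neq_double.
  have: 2%:R * (1 + 2%:R * (a' + a' ^+ 2 + b' + b' ^+ 2
                            + c * (1 + 2%:R * b') ^+ 2)) = 0.
    by rewrite -[RHS]E /=; ring.
  move/eqP; rewrite mulf_eq0 (negPf (dyadic_nat_neq0 1)) => /eqP/odd_neq0.
  move/(_ (- (a' + a' ^+ 2 + b' + b' ^+ 2 + c * (1 + 2%:R * b') ^+ 2))) => [].
  ring.
Qed.

(** By infinite descent, a and b are divisible by every power of 2. In effect, -1 and -5 are not
    squares in Q_2. *)
Lemma dyadic_norm_eq0 (a b : Z2) :
  a ^+ 2 + (1 + 4%:R * e%:R) * b ^+ 2 = 0 -> a = 0 /\ b = 0.
Proof.
have div_pow n (x y : Z2) : x ^+ 2 + (1 + 4%:R * e%:R) * y ^+ 2 = 0 ->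
    (exists x', x = (2 ^ n)%:R * x') /\ (exists y', y = (2 ^ n)%:R * y').
  elim: n x y => [|n IHn] x y; first by split; [exists x | exists y]; rewrite mul1r.
  case/dyadic_norm_descent=> x1 [y1 [-> -> /IHn[[x2 ->] [y2 ->]]]].
  by split; [exists x2 | exists y2]; rewrite mulrA -natrM expnS.
by move=> E; split; apply: padic_int_separated => n; case: (div_pow n _ _ E).
Qed.

Lemma coord_inj a b a' b' :
  iota a + iota b * t = iota a' + iota b' * t -> a = a' /\ b = b'.
Proof.
move=> /eqP; rewrite -subr_eq0 => /eqP E.
suff [/eqP + /eqP] : a - a' = 0 /\ b - b' = 0.
  by rewrite !subr_eq0 => /eqP-> /eqP->.
apply: dyadic_norm_eq0; apply: iota_inj; rewrite iota0.
rewrite iotaD (iotaM (1 + _)) iota_norm 2!iotaX 2!iotaB.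
have -> : 1 + 4%:R * e%:R = - t ^+ 2 by rewrite t_sqr opprK.
(* The norm of the difference is the product of its conjugate with the difference itself, which is
   0. *)
rewrite -[RHS](mulr0 (iota a - iota a' - (iota b - iota b') * t)) -[in RHS]E.
ring.
Qed.

(** An element of valuation -1: its norm is (1 + 2e) / 2. With it, lying in P^n becomes integrality
    after multiplication by theta^n. *)
Definition theta : K := (1 - t) / 2%:R.

Lemma theta_norm : (1 + t) * theta = 1 + 2%:R * e%:R.
Proof.
apply: (mulIf (natK_neq0 1)); rewrite /theta mulrA mulfVK ?natK_neq0 //.
have -> : (1 + t) * (1 - t) = 1 - t ^+ 2 by ring.
by rewrite t_sqr; ring.
Qed.

Lemma norm_neq0 : 1 + 2%:R * e%:R != 0 :> K.
Proof. by case: (e); rewrite ?mulr0 ?addr0 ?oner_neq0 // mulr1 nat1r natK_neq0. Qed.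

Lemma theta_neq0 : theta != 0.
Proof. by apply: contraNneq norm_neq0 => th0; rewrite -theta_norm th0 mulr0. Qed.

Lemma inv_norm_integral : (1 + 2%:R * e%:R : K)^-1 \in integral.
Proof.
case: (e); last by rewrite mulr0 addr0 invr1 rpred1.
have [x x3] := dyadic_inv3; rewrite mulr1 nat1r.
suff -> : (3%:R : K)^-1 = iota x by apply: iota_integral.
apply: (mulfI (natK_neq0 2)); rewrite mulfV ?natK_neq0 //.
by rewrite -(iota_nat 3) -iotaM x3 iota1.
Qed.

Lemma inv_theta : theta^-1 = (1 + t) / (1 + 2%:R * e%:R).
Proof.
by apply: (mulIf theta_neq0); rewrite mulVf ?theta_neq0 // mulrAC theta_norm
  mulfV ?norm_neq0.
Qed.

Lemma inv_theta_integral : theta^-1 \in integral.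
Proof. by rewrite inv_theta rpredM ?inv_norm_integral ?rpredD ?rpred1 ?t_integral. Qed.

(* The n-th power of the maximal ideal, generated by [theta^-1]. *)
Definition maxideal n : {pred K} := fun x => x * theta ^+ n \in integral.

Lemma maxidealE n x : (x \in maxideal n) = (x * theta ^+ n \in integral).
Proof. by []. Qed.

Fact maxideal_zmod n : zmod_closed (maxideal n).
Proof.
split=> [|x y]; rewrite !maxidealE ?mul0r ?rpred0 // => Ix Iy.
by rewrite mulrBl rpredB.
Qed.
HB.instance Definition _ n :=
  GRing.isZmodClosed.Build K (maxideal n) (maxideal_zmod n).

Lemma maxideal0 x : (x \in maxideal 0) = (x \in integral).
Proof. by rewrite maxidealE mulr1. Qed.

Lemma maxidealM m n x y :
  x \in maxideal m -> y \in maxideal n -> x * y \in maxideal (m + n).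
Proof. by rewrite !maxidealE exprD mulrACA; apply: rpredM. Qed.

Lemma maxidealMl n x y : x \in integral -> y \in maxideal n -> x * y \in maxideal n.
Proof. by rewrite -maxideal0; apply: maxidealM. Qed.

Lemma maxideal_le m n x : (m <= n)%N -> x \in maxideal n -> x \in maxideal m.
Proof.
move=> /subnKC <-; rewrite !maxidealE exprD => Ix.
rewrite -(mulfK (expf_neq0 (n - m) theta_neq0) (x * _)) -mulrA -exprVn.
by rewrite mulrA -(mulrA x) rpredM ?rpredX ?inv_theta_integral.
Qed.

Lemma maxideal_integral n x : x \in maxideal n -> x \in integral.
Proof. by rewrite -maxideal0; apply: maxideal_le. Qed.

Lemma maxideal_theta n x : (x * theta \in maxideal n) = (x \in maxideal n.+1).
Proof. by rewrite !maxidealE exprS mulrA. Qed.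

(** Ramification of 2: 2 theta^2 = -(2e + t) is integral. *)
Lemma two_maxideal : 2%:R \in maxideal 2.
Proof.
have two_theta : 2%:R * theta ^+ 2 = - (2%:R * e%:R) - t.
  apply: (mulfI (natK_neq0 1)); rewrite mulrA -expr2 -exprMn.
  rewrite [2%:R * theta]mulrC mulfVK ?natK_neq0 //.
  have -> : (1 - t) ^+ 2 = 1 + t ^+ 2 - 2%:R * t by ring.
  by rewrite t_sqr; ring.
rewrite maxidealE two_theta rpredB ?t_integral // rpredN.
by rewrite rpredM ?rpred_nat.
Qed.

Lemma one_minus_t_maxideal : 1 - t \in maxideal 1.
Proof.
have -> : 1 - t = 2%:R * theta by rewrite mulrC mulfVK ?natK_neq0.
by rewrite maxideal_theta two_maxideal.
Qed.

(** The residue field is F_2: both 2 and 1 - t lie in P, so a + b t is congruent to a + b. *)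
Lemma integral_parity x :
  x \in integral -> x \in maxideal 1 \/ x - 1 \in maxideal 1.
Proof.
case/integralP=> a [b ->].
have [u [a' ->]] := dyadic_parity a; have [v [b' ->]] := dyadic_parity b.
rewrite (iotaD u%:R) (iotaD v%:R) (iotaM 2%:R a') (iotaM 2%:R b').
rewrite (iota_nat u) (iota_nat v) (iota_nat 2).
set y := iota a' + iota b' * t.
have Iy2 : y * 2%:R \in maxideal 1.
  apply: maxidealMl; last exact: maxideal_le two_maxideal.
  by rewrite rpredD ?rpredM ?iota_integral ?t_integral.
have two1 := maxideal_le (isT : 1 <= 2)%N two_maxideal.
have It := one_minus_t_maxideal.
case: u v => [] []; [left | right | right | left].
- have -> : true%:R + 2%:R * iota a' + (true%:R + 2%:R * iota b') * t
    = 2%:R - (1 - t) + y * 2%:R by rewrite /y /=; ring.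
  by rewrite rpredD // rpredB.
- have -> : true%:R + 2%:R * iota a' + (false%:R + 2%:R * iota b') * t - 1
    = y * 2%:R by rewrite /y /=; ring.
  by [].
- have -> : false%:R + 2%:R * iota a' + (true%:R + 2%:R * iota b') * t - 1
    = - (1 - t) + y * 2%:R by rewrite /y /=; ring.
  by rewrite rpredD // rpredN.
- have -> : false%:R + 2%:R * iota a' + (false%:R + 2%:R * iota b') * t
    = y * 2%:R by rewrite /y /=; ring.
  by [].
Qed.

(** Otherwise theta = (1 - t) / 2 would be integral, and comparing coordinates would make 1 even in
    Z_2. *)
Lemma one_notin_maxideal : 1 \notin maxideal 1.
Proof.
apply/negP; rewrite maxidealE mul1r => /integralP[a [b Dth]].
have [] := @coord_inj 1 (-1) (2%:R * a) (2%:R * b); last first.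
  by move=> /dyadic_one_neq_double.
rewrite !(iotaM 2%:R) (iota_nat 2) iota1 iotaN iota1 mulN1r -mulrA -mulrDr -Dth expr1.
by rewrite mulrC mulfVK ?natK_neq0.
Qed.

(** The valuation of 2 is exactly 2: -(2e + t) is a unit, whose inverse is its conjugate t - 2e over
    its norm (1 + 2e)^2. *)
Lemma maxideal_half n x : x \in maxideal n.+2 -> x / 2%:R \in maxideal n.
Proof.
have half_int : (2%:R * theta ^+ 2)^-1 \in integral.
  suff -> : (2%:R * theta ^+ 2)^-1
          = (t - 2%:R * e%:R) / (1 + 2%:R * e%:R) ^+ 2.
    rewrite rpredM // ?rpredB ?rpredM ?rpred_nat ?t_integral //.
    by rewrite -exprVn rpredX ?inv_norm_integral.
  rewrite invfM -(exprVn theta) inv_theta exprMn exprVn mulrA; congr (_ / _).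
  apply: (mulfI (natK_neq0 1)); rewrite mulrA mulfV ?natK_neq0 // mul1r.
  have -> : (1 + t) ^+ 2 = 1 + t ^+ 2 + 2%:R * t by ring.
  by rewrite t_sqr; ring.
rewrite !maxidealE => Ix.
have -> : x / 2%:R * theta ^+ n
        = x * theta ^+ n.+2 * (2%:R * theta ^+ 2)^-1.
  by rewrite -(addn2 n) exprD; field; rewrite theta_neq0 natK_neq0.
exact: rpredM.
Qed.

(** Even powers of P are generated by powers of 2, which carries separation and completeness over
    from the coordinates in Z_2. *)
Lemma maxideal_double n x :
  x \in maxideal n.*2 -> exists2 y, y \in integral & x = (2 ^ n)%:R * y.
Proof.
elim: n x => [|n IHn] x; first by rewrite maxideal0; exists x; rewrite ?mul1r.
rewrite doubleS => /maxideal_half/IHn[y Iy Dx]; exists y => //.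
by rewrite expnS natrM -mulrA -Dx mulrC divfK ?natK_neq0.
Qed.

Lemma maxideal_separated x : (forall n, x \in maxideal n) -> x = 0.
Proof.
move=> Ix; have /integralP[a [b Dx]] := maxideal_integral (Ix 0%N).
have coord_div n :
    (exists y, a = (2 ^ n)%:R * y) /\ (exists y, b = (2 ^ n)%:R * y).
  have [y /integralP[a' [b' ->]]] := maxideal_double (Ix n.*2).
  rewrite Dx mulrDr mulrA -iota_nat -!iotaM => /coord_inj[-> ->].
  by split; [exists a' | exists b'].
rewrite Dx (@padic_int_separated _ _ a); last by move=> n; case: (coord_div n).
rewrite (@padic_int_separated _ _ b); last by move=> n; case: (coord_div n).
by rewrite iota0 mul0r addr0.
Qed.

(** Successive terms of even index differ by a multiple of 2^n, so both coordinates converge in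
    Z_2. *)
Lemma maxideal_complete (f : nat -> K) :
    (forall n, f n \in integral) -> (forall n, f n.+1 - f n \in maxideal n) ->
  exists2 l, l \in integral & forall n, l - f n.*2 \in maxideal n.
Proof.
move=> f_int f_cauchy.
have f2_cauchy n : f n.*2.+2 - f n.*2 \in maxideal n.*2.
  rewrite -(subrKA (f n.*2.+1)) rpredD //.
  exact: maxideal_le (leqnSn _) (f_cauchy _).
have /choice[a /choice[b f2E]] n := integralP _ (f_int n.*2).
have f2_coord n : (exists y, a n.+1 - a n = (2 ^ n)%:R * y)
    /\ (exists y, b n.+1 - b n = (2 ^ n)%:R * y).
  have [y /integralP[a' [b' ->]]] := maxideal_double (f2_cauchy n).
  rewrite -doubleS !f2E opprD addrACA -mulrBl mulrDr mulrA -iota_nat.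
  rewrite -!iotaM -!iotaB => /coord_inj[-> ->].
  by split; [exists a' | exists b'].
have [la Dla] := padic_int_complete (fun n => (f2_coord n).1).
have [lb Dlb] := padic_int_complete (fun n => (f2_coord n).2).
exists (iota la + iota lb * t) => [|n]; first by apply/integralP; exists la, lb.
have [ya Dya] := Dla n; have [yb Dyb] := Dlb n.
rewrite f2E opprD addrACA -mulrBl -!iotaB Dya Dyb !iotaM !iota_nat.
have -> : (2 ^ n)%:R * iota ya + (2 ^ n)%:R * iota yb * t
  = (iota ya + iota yb * t) * (2 ^ n)%:R by ring.
apply: maxidealMl; first by apply/integralP; exists ya, yb.
elim: n {Dya Dyb} => [|n IHn]; first by rewrite maxideal0 rpred1.
rewrite expnS natrM; apply: (@maxidealM 1 n) => //.
exact: maxideal_le two_maxideal.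
Qed.

(** * Hensel's lemma *)

Ltac solve_integral :=
  repeat first [assumption | apply: rpred_nat | apply: rpred1 | apply: rpredX
               | apply: rpredM | apply: rpredB | apply: rpredD | apply: rpredN].

Lemma maxideal1X n x : x \in maxideal 1 -> x ^+ n \in maxideal n.
Proof.
move=> Ix; elim: n => [|n IHn]; first by rewrite maxideal0 rpred1.
by rewrite exprS; apply: (@maxidealM 1 n).
Qed.

(* Writing x = 1 + 4 m and z = 1 + 2 r, the equation z ^ 6 = x becomes a fixed
   point equation for a polynomial in r that is contracting on the maximal
   ideal. *)
Lemma sixth_root x : x - 1 \in maxideal 5 -> exists2 z, z != 0 & z ^+ 6 = x.
Proof.
(* Dividing by 4, of valuation 4, leaves [m] in P, so that [Phi] below maps P to itself. *)
move=> /maxideal_half/maxideal_half; set m := _ / _ / _ => Im.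
have Dx : x = 1 + 4%:R * m.
  by rewrite /m; field; rewrite natK_neq0.
(* The equation (1 + 2r)^6 = 1 + 4m reads 3r + 15r^2 + ... + 16r^6 = m. Adding r to both sides makes
   the linear coefficient 4, and the solutions are the fixed points of [Phi]. *)
pose Phi r : K := (4%:R + 15%:R * r + 40%:R * r ^+ 2 + 60%:R * r ^+ 3
                   + 48%:R * r ^+ 4 + 16%:R * r ^+ 5) * r - m.
have Phi_int r : r \in maxideal 1 -> Phi r \in maxideal 1.
  move=> Ir; have Or := maxideal_integral Ir.
  rewrite rpredB // maxidealMl //.
  by solve_integral.
have two_int : 2%:R \in maxideal 1 by apply: maxideal_le two_maxideal.
have Phi_contr k r s : r \in maxideal 1 -> s \in maxideal 1 ->
    r - s \in maxideal k -> Phi r - Phi s \in maxideal k.+1.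
  move=> Ir Is Irs.
  have [Or Os] := (maxideal_integral Ir, maxideal_integral Is).
  (* The divided difference lies in P: all its coefficients are even except 15, which multiplies r +
     s. *)
  have -> : Phi r - Phi s = ((2%:R + 20%:R * (r ^+ 2 + r * s + s ^+ 2)
     + 30%:R * (r ^+ 3 + r ^+ 2 * s + r * s ^+ 2 + s ^+ 3)
     + 24%:R * (r ^+ 4 + r ^+ 3 * s + r ^+ 2 * s ^+ 2 + r * s ^+ 3 + s ^+ 4)
     + 8%:R * (r ^+ 5 + r ^+ 4 * s + r ^+ 3 * s ^+ 2 + r ^+ 2 * s ^+ 3
               + r * s ^+ 4 + s ^+ 5)) * 2%:R + 15%:R * (r + s)) * (r - s).
    by rewrite /Phi; ring.
  apply: (@maxidealM 1 k) => //.
  rewrite rpredD //; last by rewrite maxidealMl ?rpred_nat // rpredD.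
  by rewrite maxidealMl //; solve_integral.
pose f n := iter n Phi 0.
have f_int n : f n \in maxideal 1.
  by elim: n => [|n IHn]; rewrite ?rpred0 //=; apply: Phi_int.
have f_cauchy n : f n.+1 - f n \in maxideal n.
  elim: n => [|n IHn]; last exact: Phi_contr (f_int _) (f_int _) IHn.
  by rewrite rpredB // maxideal0 (maxideal_integral (f_int _)).
have [l _ l_lim] := maxideal_complete (fun n => maxideal_integral (f_int n)) f_cauchy.
have Il : l \in maxideal 1.
  by rewrite -(subrK (f 2) l) rpredD ?(l_lim 1%N).
have Phi_l : Phi l - l = 0.
  apply: maxideal_separated => n.
  (* As [f n.*2.+1] is the image of [f n.*2], contraction bounds the first difference. *)
  have -> : Phi l - l = (Phi l - f n.*2.+1) + (f n.*2.+1 - f n.*2) - (l - f n.*2).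
    by ring.
  rewrite rpredB ?l_lim // rpredD //.
    exact: maxideal_le (leqnSn n) (Phi_contr _ _ _ Il (f_int _) (l_lim n)).
  by apply: maxideal_le (f_cauchy _); rewrite -addnn leq_addr.
exists (1 + 2%:R * l).
  apply: contra one_notin_maxideal => /eqP z0.
  have -> : 1 = - (2%:R * l) by apply/eqP; rewrite -subr_eq0 opprK z0.
  by rewrite rpredN maxidealMl ?rpred_nat.
rewrite Dx; apply/eqP; rewrite -subr_eq0 -[X in _ == X](mulr0 4%:R) -Phi_l.
by apply/eqP; rewrite /Phi; ring.
Qed.

(** * Sixth powers modulo small powers of the maximal ideal *)

Lemma expr6_maxideal x : x \in integral -> x ^+ 6 \in maxideal 1 -> x \in maxideal 1.
Proof.
move=> Ox; case: (integral_parity Ox) => // Ix1 Ix6.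
case/negP: one_notin_maxideal.
have -> : 1 = x ^+ 6 - (1 + x + x ^+ 2 + x ^+ 3 + x ^+ 4 + x ^+ 5) * (x - 1).
  by ring.
by rewrite rpredB // maxidealMl // !rpredD ?rpredX ?rpred1.
Qed.

(** For a unit x, x^2 - 1 = (x - 1)^2 + 2(x - 1) lies in P^2, and x^2 - 1 divides x^6 - 1. *)
Lemma integral_expr6 x : x \in integral ->
  x \in maxideal 1 \/ x ^+ 6 - 1 \in maxideal 2.
Proof.
move=> Ox; have [|Ix] := integral_parity Ox; [by left | right].
have I2 : x ^+ 2 - 1 \in maxideal 2.
  have -> : x ^+ 2 - 1 = (x - 1) * (x - 1) + (x - 1) * 2%:R by ring.
  rewrite rpredD //; first exact: (maxidealM Ix Ix).
  exact: maxidealMl (maxideal_integral Ix) two_maxideal.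
have -> : x ^+ 6 - 1 = (1 + x ^+ 2 + x ^+ 4) * (x ^+ 2 - 1) by ring.
by rewrite maxidealMl // !rpredD ?rpredX ?rpred1.
Qed.

(** If exactly one of x and y is a unit, so is the sum; if both are, the sum is congruent to 1 + t
    modulo P^2, and 1 + t has valuation 1. *)
Lemma expr6_pair_maxideal x y : x \in integral -> y \in integral ->
  x ^+ 6 + t * y ^+ 6 \in maxideal 2 -> x \in maxideal 1 /\ y \in maxideal 1.
Proof.
move=> Ox Oy Ixy.
have It : 1 - t \in maxideal 1 := one_minus_t_maxideal.
have one_not : ~ 1 \in maxideal 1 by apply/negP/one_notin_maxideal.
have Ixy1 := maxideal_le (isT : 1 <= 2)%N Ixy.
have odd1 z : z ^+ 6 - 1 \in maxideal 2 -> z ^+ 6 - 1 \in maxideal 1.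
  exact: maxideal_le.
have even1 z : z \in maxideal 1 -> z ^+ 6 \in maxideal 1.
  by move/(maxideal1X 6)/maxideal_le; apply.
have [Ix | Ix] := integral_expr6 Ox; have [Iy | Iy] := integral_expr6 Oy => //.
- case: one_not.
  have -> : 1 = (x ^+ 6 + t * y ^+ 6) - x ^+ 6 - t * (y ^+ 6 - 1) + (1 - t) by ring.
  have It' : t * (y ^+ 6 - 1) \in maxideal 1 := maxidealMl t_integral (odd1 _ Iy).
  by rewrite rpredD // rpredB // rpredB // even1.
- case: one_not.
  have -> : 1 = (x ^+ 6 + t * y ^+ 6) - (x ^+ 6 - 1) - t * y ^+ 6 by ring.
  have It' : t * y ^+ 6 \in maxideal 1 := maxidealMl t_integral (even1 _ Iy).
  by rewrite rpredB // rpredB // odd1.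
case: one_not.
have: (x ^+ 6 + t * y ^+ 6) - (x ^+ 6 - 1) - t * (y ^+ 6 - 1) \in maxideal 2.
  by rewrite rpredB ?maxidealMl ?t_integral // rpredB.
have -> : (x ^+ 6 + t * y ^+ 6) - (x ^+ 6 - 1) - t * (y ^+ 6 - 1) = 1 + t by ring.
rewrite -(maxideal_theta 1 (1 + t)) theta_norm => Ih.
have -> : 1 = (1 + 2%:R * e%:R) - e%:R * 2%:R :> K by ring.
rewrite rpredB // maxidealMl ?rpred_nat //.
exact: maxideal_le two_maxideal.
Qed.

Definition same_class (x y : K) := exists2 z, z != 0 & x = y * z ^+ 6.

Lemma same_class_refl x : same_class x x.
Proof. by exists 1; rewrite ?oner_neq0 // expr1n mulr1. Qed.

Lemma same_class_sym x y : same_class x y -> same_class y x.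
Proof.
case=> z z0 ->; exists z^-1; first by rewrite invr_eq0.
by rewrite exprVn mulfK ?expf_neq0.
Qed.

Lemma same_class_trans y x z : same_class x y -> same_class y z -> same_class x z.
Proof.
case=> u u0 -> [v v0 ->]; exists (v * u); first exact: mulf_neq0.
by ring.
Qed.

Lemma same_classM x y x' y' :
  same_class x y -> same_class x' y' -> same_class (x * x') (y * y').
Proof.
case=> u u0 -> [v v0 ->]; exists (u * v); first exact: mulf_neq0.
by ring.
Qed.

Lemma same_class_sixth x z : z != 0 -> same_class (x * z ^+ 6) x.
Proof. by exists z. Qed.

(** If u v^5 c^6 = z^6, then u = v (z / (v c))^6; the factor c^6 allows for sixth powers outside 1 +
    P^5. *)
Lemma same_class_unit u v c : c != 0 -> v != 0 ->
  u * v ^+ 5 * c ^+ 6 - 1 \in maxideal 5 -> same_class u v.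
Proof.
move=> c0 v0 /sixth_root[z z0 Dz]; exists (z / (v * c)).
  by rewrite mulf_neq0 // invr_eq0 mulf_neq0.
by rewrite expr_div_n Dz; field; rewrite c0 v0.
Qed.

(** * The lower bound: an anisotropic form in six variables *)

Definition form6 (w x1 x2 x3 x4 x5 x6 : K) :=
  x1 ^+ 6 + w * (x2 ^+ 6 + t * x3 ^+ 6) + w ^+ 3 * (x4 ^+ 6 + t * x5 ^+ 6)
    + w ^+ 5 * x6 ^+ 6.

Lemma maxideal_thetaX k n x :
  (x * theta ^+ k \in maxideal n) = (x \in maxideal (k + n)).
Proof. by rewrite !maxidealE exprD mulrA. Qed.

(* The four parts of the form have valuations 0, {1, 2}, {3, 4} and 5 modulo 6. *)
Lemma form6_maxideal x1 x2 x3 x4 x5 x6 :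
    all [in integral] [:: x1; x2; x3; x4; x5; x6] ->
    form6 theta^-1 x1 x2 x3 x4 x5 x6 = 0 ->
  all [in maxideal 1] [:: x1; x2; x3; x4; x5; x6].
Proof.
have th0 := theta_neq0.
rewrite /= andbT => /and5P[O1 O2 O3 O4 /andP[O5 O6]].
have Ot := t_integral.
rewrite /form6; set w := theta^-1; set A := x2 ^+ 6 + _; set B := x4 ^+ 6 + _.
move=> F0.
have Iw m n x : x \in maxideal n -> w ^+ m * x \in maxideal (m + n).
  rewrite maxidealE -maxideal_thetaX mulrAC exprVn mulVf ?mul1r //.
  exact: expf_neq0.
have OA : A \in maxideal 0 by rewrite maxideal0 /A; solve_integral.
have OB : B \in maxideal 0 by rewrite maxideal0 /B; solve_integral.
have OC : x6 ^+ 6 \in maxideal 0 by rewrite maxideal0; solve_integral.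
have I1 : x1 \in maxideal 1.
  apply: expr6_maxideal => //.
  have -> : x1 ^+ 6 = - (w ^+ 1 * A + w ^+ 3 * B + w ^+ 5 * x6 ^+ 6).
    by apply/eqP; rewrite -subr_eq0 -[X in _ == X]F0; apply/eqP; ring.
  rewrite rpredN; apply: rpredD; [apply: rpredD |].
  - exact: (Iw 1%N).
  - exact: maxideal_le (Iw 3 _ _ OB).
  - exact: maxideal_le (Iw 5 _ _ OC).
have I16 := maxideal1X 6 I1.
(* Now all terms other than w A lie in P^3, so A lies in P^2 and the criterion for pairs applies. *)
have [I2 I3] : x2 \in maxideal 1 /\ x3 \in maxideal 1.
  apply: expr6_pair_maxideal => //; rewrite -/A.
  have -> : A = - (x1 ^+ 6 + w ^+ 3 * B + w ^+ 5 * x6 ^+ 6) * theta ^+ 1.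
    rewrite -[LHS](mulKf (invr_neq0 th0)) invrK mulrC; congr (_ * _); rewrite -/w.
    by apply/eqP; rewrite -subr_eq0 -[X in _ == X]F0; apply/eqP; ring.
  rewrite maxideal_thetaX rpredN; apply: rpredD; [apply: rpredD |].
  - exact: maxideal_le I16.
  - exact: (Iw 3).
  - exact: maxideal_le (Iw 5 _ _ OC).
have IA : A \in maxideal 6.
  by apply: rpredD; [|apply: maxidealMl => //]; apply: maxideal1X.
(* All terms other than w^3 B now lie in P^5, so B lies in P^2. *)
have [I4 I5] : x4 \in maxideal 1 /\ x5 \in maxideal 1.
  apply: expr6_pair_maxideal => //; rewrite -/B.
  have -> : B = - (x1 ^+ 6 + w ^+ 1 * A + w ^+ 5 * x6 ^+ 6) * theta ^+ 3.
    rewrite -[LHS](mulKf (expf_neq0 3 (invr_neq0 th0))) exprVn invrK mulrC.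
    congr (_ * _); rewrite -exprVn -/w.
    by apply/eqP; rewrite -subr_eq0 -[X in _ == X]F0; apply/eqP; ring.
  rewrite maxideal_thetaX rpredN; apply: rpredD; [apply: rpredD |].
  - exact: maxideal_le I16.
  - exact: maxideal_le (Iw 1 _ _ IA).
  - exact: (Iw 5).
have IB : B \in maxideal 6.
  by apply: rpredD; [|apply: maxidealMl => //]; apply: maxideal1X.
have I6 : x6 \in maxideal 1.
  apply: expr6_maxideal => //.
  have -> : x6 ^+ 6 = - (x1 ^+ 6 + w ^+ 1 * A + w ^+ 3 * B) * theta ^+ 5.
    rewrite -[LHS](mulKf (expf_neq0 5 (invr_neq0 th0))) exprVn invrK mulrC.
    congr (_ * _); rewrite -exprVn -/w.
    by apply/eqP; rewrite -subr_eq0 -[X in _ == X]F0; apply/eqP; ring.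
  rewrite maxideal_thetaX rpredN; apply: rpredD; [apply: rpredD |].
  - exact: maxideal_le I16.
  - exact: maxideal_le (Iw 1 _ _ IA).
  - exact: maxideal_le (Iw 3 _ _ IB).
by rewrite I1 I2 I3 I4 I5 I6.
Qed.

Lemma form6_scale c x1 x2 x3 x4 x5 x6 :
  form6 theta^-1 (x1 * c) (x2 * c) (x3 * c) (x4 * c) (x5 * c) (x6 * c)
    = c ^+ 6 * form6 theta^-1 x1 x2 x3 x4 x5 x6.
Proof. by rewrite /form6; ring. Qed.

(** Infinite descent: an integral zero stays integral after multiplication by theta, so its entries
    lie in every power of P. *)
Lemma form6_integral_eq0 x1 x2 x3 x4 x5 x6 :
    all [in integral] [:: x1; x2; x3; x4; x5; x6] ->
    form6 theta^-1 x1 x2 x3 x4 x5 x6 = 0 ->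
  all (pred1 0) [:: x1; x2; x3; x4; x5; x6].
Proof.
move=> Ox F0.
have Ix n : all [in maxideal n] [:: x1; x2; x3; x4; x5; x6].
  elim: n x1 x2 x3 x4 x5 x6 Ox F0 => [|n IHn] y1 y2 y3 y4 y5 y6 Oy F0.
    by move: Oy; rewrite /= !maxideal0.
  have := form6_maxideal Oy F0; rewrite /= !maxidealE !expr1 => Iy.
  have := IHn _ _ _ _ _ _ Iy; rewrite form6_scale F0 mulr0 => /(_ erefl).
  by rewrite /= !maxideal_theta.
apply/allP => x x_in; apply/eqP/maxideal_separated => n.
exact: (allP (Ix n)).
Qed.

Lemma integral_multiple x :
  exists c, [/\ c != 0, c \in integral & x * c \in integral].
Proof.
have [a [b [c [c0 Dx]]]] := iota_frac x; exists (iota c).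
split; [by rewrite -iota0 (inj_eq iota_inj) | exact: iota_integral |].
by apply/integralP; exists a, b.
Qed.

Lemma common_integral_multiple (s : seq K) :
  exists c, [/\ c != 0, c \in integral & all (fun x => x * c \in integral) s].
Proof.
elim: s => [|x s [c [c0 Oc /allP Os]]]; first by exists 1; rewrite oner_neq0 rpred1.
have [c' [c'0 Oc' Ox]] := integral_multiple x.
exists (c * c'); split; [exact: mulf_neq0 | exact: rpredM |].
rewrite /= mulrCA rpredM //; apply/allP => y /Os Oy.
by rewrite mulrA rpredM.
Qed.

Lemma form6_eq0 x1 x2 x3 x4 x5 x6 :
    form6 theta^-1 x1 x2 x3 x4 x5 x6 = 0 ->
  all (pred1 0) [:: x1; x2; x3; x4; x5; x6].
Proof.
move=> F0.
have [c [c0 _ Oxc]] := common_integral_multiple [:: x1; x2; x3; x4; x5; x6].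
have := @form6_integral_eq0 (x1 * c) (x2 * c) (x3 * c) (x4 * c) (x5 * c) (x6 * c).
rewrite form6_scale F0 mulr0 => /(_ Oxc erefl).
by rewrite /= !mulf_eq0 (negPf c0) !orbF.
Qed.

Lemma not_diagonal_solvable6 : exists a : 'rV[K]_6,
  ~ exists2 x : 'rV[K]_6, x != 0 & \sum_(i < 6) a 0 i * x 0 i ^+ 6 = 0.
Proof.
set w := theta^-1.
exists (\row_i [:: 1; w; w * t; w ^+ 3; w ^+ 3 * t; w ^+ 5]`_i) => -[x /negP x0].
pose y k := x 0 (inord k).
under eq_bigr => i _ do rewrite mxE -[x 0 i](congr1 (x 0) (inord_val i)) -/(y i).
rewrite -(big_mkord xpredT (fun i => [:: 1; w; w * t; w ^+ 3; w ^+ 3 * t; w ^+ 5]`_i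
                                     * y i ^+ 6)).
rewrite unlock /= => E; apply: x0; apply/eqP/rowP => i; rewrite mxE.
have /allP y0 : all (pred1 0) [:: y 0%N; y 1%N; y 2; y 3; y 4; y 5].
  by apply: form6_eq0; rewrite -[RHS]E /form6 -/w; ring.
rewrite -(inord_val i) -/(y i); apply/eqP/y0.
by case: i => [[|[|[|[|[|[|//]]]]]] ?]; rewrite !inE eqxx ?orbT.
Qed.

(** * Classes modulo sixth powers *)

Definition intZ (m : Z) : K := (int_of_Z m)%:~R.

Lemma intZD m n : intZ (Z.add m n) = intZ m + intZ n.
Proof. by rewrite /intZ -intrD -(rmorphD int_of_Z). Qed.

Lemma intZB m n : intZ (Z.sub m n) = intZ m - intZ n.
Proof. by rewrite /intZ -intrB -(rmorphB int_of_Z). Qed.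

Lemma intZM m n : intZ (Z.mul m n) = intZ m * intZ n.
Proof. by rewrite /intZ -intrM -(rmorphM int_of_Z). Qed.

Lemma intZ_nat (n : nat) : intZ (Z.of_nat n) = n%:R.
Proof. by rewrite /intZ -[Z.of_nat n]/(Z_of_int n) Z_of_intK pmulrn. Qed.

Lemma intZ_integral m : intZ m \in integral.
Proof. exact: rpred_int. Qed.

Definition quad (a : Z * Z) : K := intZ a.1 + intZ a.2 * t.

Lemma quadE m n : quad (m, n) = intZ m + intZ n * t.
Proof. by []. Qed.

Lemma quad_integral a : quad a \in integral.
Proof.
have [O1 O2] := (intZ_integral a.1, intZ_integral a.2); have Ot := t_integral.
by rewrite /quad; solve_integral.
Qed.

Lemma quadD a b : quad (quad_add a b) = quad a + quad b.
Proof. by rewrite /quad /= !intZD; ring. Qed.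

Lemma intZ_norm : intZ (quad_norm e) = - t ^+ 2.
Proof.
rewrite t_sqr opprK; case: (e).
  by rewrite -[quad_norm true]/(Z.of_nat 5) intZ_nat /=; ring.
by rewrite -[quad_norm false]/(Z.of_nat 1) intZ_nat /=; ring.
Qed.

Lemma quadM a b : quad (quad_mul e a b) = quad a * quad b.
Proof. by rewrite /quad /= intZB intZD !intZM intZ_norm; ring. Qed.

Lemma quad1 : quad (1, 0) = 1.
Proof. by rewrite /quad /intZ /= mul0r addr0. Qed.

Lemma quad_exp6E a : quad (quad_exp6 e a) = quad a ^+ 6.
Proof. by rewrite /quad_exp6 !quadM; ring. Qed.

(** m + n t = (m + n) - n (1 - t) is congruent to m + n modulo P. *)
Lemma quad_odd m n : Z.odd (Z.add m n) -> quad (m, n) \notin maxideal 1.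
Proof.
move=> odd_mn; apply: contra one_notin_maxideal => Iq.
have Dm : m = Z.sub (Z.add (Z.mul 2 (Z.div2 (Z.add m n))) 1) n.
  by have := Z.div2_odd (Z.add m n); rewrite odd_mn; lia.
have -> : 1 = quad (m, n) + intZ n * (1 - t) - intZ (Z.div2 (Z.add m n)) * 2%:R.
  by rewrite /quad /= [in intZ m]Dm intZB intZD intZM (intZ_nat 2) (intZ_nat 1); ring.
apply: rpredB; first apply: rpredD => //; apply: maxidealMl (intZ_integral _) _.
  exact: one_minus_t_maxideal.
exact: maxideal_le two_maxideal.
Qed.

(** With t^2 = -d, (m + n t)(1 - t) = (m + d n) + (n - m) t, and both coordinates are even. This is
    the recursive step of [class_index]. *)
Lemma quad_even m n : ~~ Z.odd (Z.add m n) ->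
  quad (m, n) * theta
    = quad (Z.div2 (Z.add m (Z.mul (quad_norm e) n)), Z.div2 (Z.sub n m)).
Proof.
move=> even_mn.
set a := Z.div2 _; set b := Z.div2 _.
have Da : Z.add m (Z.mul (quad_norm e) n) = Z.mul 2 a.
  have := Z.div2_odd (Z.add m (Z.mul (quad_norm e) n)).
  have -> : Z.odd (Z.add m (Z.mul (quad_norm e) n)) = false.
    move: even_mn; rewrite !Z.odd_add Z.odd_mul.
    by have -> : Z.odd (quad_norm e) by [case: (e)]; case: Z.odd; case: Z.odd.
  by rewrite -/a; lia.
have Db : Z.sub n m = Z.mul 2 b.
  have := Z.div2_odd (Z.sub n m); rewrite -/b.
  have -> : Z.odd (Z.sub n m) = false.
    by move: even_mn; rewrite Z.odd_add Z.odd_sub; case: Z.odd; case: Z.odd.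
  by lia.
apply: (mulIf (natK_neq0 1)); rewrite -mulrA mulfVK ?natK_neq0 //.
have := congr1 intZ Da; have := congr1 intZ Db.
rewrite intZB intZD !intZM intZ_norm (intZ_nat 2) /quad /= => Eb Ea.
have -> : (intZ a + intZ b * t) * 2%:R = 2%:R * intZ a + 2%:R * intZ b * t by ring.
by rewrite -Ea -Eb; ring.
Qed.

Lemma one_mod5_maxideal a : one_mod5 a -> quad a - 1 \in maxideal 5.
Proof.
case: a => m n /and3P[/Z.eqb_eq m4 /Z.eqb_eq n4 /Z.eqb_eq mn8].
have [//|x /= Ex] := (Z.mod_divide _ _ _).1 m4.
have [//|y /= Ey] := (Z.mod_divide _ _ _).1 n4.
have [//|z /= Ez] := (Z.mod_divide _ _ _).1 mn8.
have Dm : m = Z.add (Z.mul 4 x) 1 by lia.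
have Dn : n = Z.mul 4 y by lia.
have Dx : x = Z.sub (Z.mul 2 z) y by lia.
rewrite Dm Dx Dn quadE intZD !intZM intZB intZM !(intZ_nat 4) (intZ_nat 2) (intZ_nat 1).
(* The factors 2, 2 and 2z - y (1 - t) contribute valuations 2, 2 and at least 1. *)
have -> : 4%:R * (2%:R * intZ z - intZ y) + 1%:R + 4%:R * intZ y * t - 1
  = 2%:R * (2%:R * (intZ z * 2%:R - intZ y * (1 - t))) by ring.
apply: (@maxidealM 2 3); first exact: two_maxideal.
apply: (@maxidealM 2 1); first exact: two_maxideal.
apply: rpredB; apply: maxidealMl (intZ_integral _) _.
  exact: maxideal_le two_maxideal.
exact: one_minus_t_maxideal.
Qed.

Lemma eight_maxideal : 8%:R \in maxideal 5.
Proof.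
have -> : 8%:R = 2%:R * (2%:R * 2%:R) :> K by ring.
apply: (@maxideal_le 5 6) => //.
by apply: (@maxidealM 2 4); [| apply: (@maxidealM 2 2)]; apply: two_maxideal.
Qed.

(** Only u modulo P^5 matters, so u may be an arbitrary element of K approximated by integer
    coordinates. *)
Lemma same_unit_class_quad u a b :
    u - quad a \in maxideal 5 -> quad b != 0 -> same_unit_class e a b ->
  same_class u (quad b).
Proof.
move=> Iu b0.
have t0 : quad (0, 1) != 0.
  by apply: contraNneq (@quad_odd 0 1 isT) => ->; rewrite rpred0.
have lift c : quad c != 0 -> quad a * quad b ^+ 5 * quad c ^+ 6 - 1 \in maxideal 5 ->
    same_class u (quad b).
  move=> c0 Ic; apply: (same_class_unit c0 b0).
  have -> : u * quad b ^+ 5 * quad c ^+ 6 - 1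
    = quad b ^+ 5 * quad c ^+ 6 * (u - quad a)
      + (quad a * quad b ^+ 5 * quad c ^+ 6 - 1) by ring.
  by rewrite rpredD // maxidealMl // rpredM ?rpredX ?quad_integral.
case/orP=> /one_mod5_maxideal; rewrite !(quadM, quad_exp6E) => Iab.
  apply: (lift (1, 0)); rewrite quad1 ?oner_neq0 // expr1n mulr1.
  by rewrite (_ : quad b ^+ 5 = quad b * (quad b * quad b * (quad b * quad b))) //; ring.
apply: (lift (0, 1)) => //.
by rewrite (_ : quad b ^+ 5 = quad b * (quad b * quad b * (quad b * quad b))) //; ring.
Qed.

Lemma unit_table_correct :
  all (fun m => all (fun n => Z.odd (Z.add m n) ==>
    let j := unit_index (unit_table e) m n in
    (j < 8)%N && same_unit_class e (m, n) (nth (Zpos 1, Z0) unit_reps j))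
    residues8) residues8.
Proof. by case: (e); vm_compute. Qed.

Definition unit_rep j : K := quad (nth (Zpos 1, Z0) unit_reps j).

Lemma unit_rep_neq0 j : unit_rep j != 0.
Proof.
suff odd_rep : unit_rep j \notin maxideal 1.
  by apply: contraNneq odd_rep => ->; rewrite rpred0.
do 8?[case: j => [|j]; first exact: quad_odd].
(* From index 8 on, the default value is 1. *)
by rewrite /unit_rep nth_default //; apply: quad_odd.
Qed.

Lemma unit_index_correct u m n :
    u - quad (m, n) \in maxideal 5 -> Z.odd (Z.add m n) ->
  let j := unit_index (unit_table e) m n in
  (j < 8)%N /\ same_class u (unit_rep j).
Proof.
move=> Iu odd_mn /=.
have land7 k : exists q, k = Z.add (Z.land k 7) (Z.mul 8 q).
  exists (Z.div k 8); rewrite (Z.land_ones k 3) //.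
  by rewrite Z.add_comm -Z.div_mod.
have mem_land7 k : Z.land k 7 \in residues8.
  rewrite (Z.land_ones k 3) //.
  have := Z.mod_pos_bound k 8 erefl; move: (Z.modulo k _) => x x8.
  suff : List.In x residues8 by move=> /=; do 8?[case=> [<- //|]].
  by rewrite /=; lia.
have [[q Dm] [r Dn]] := (land7 m, land7 n).
have Iu' : u - quad (Z.land m 7, Z.land n 7) \in maxideal 5.
  have -> : u - quad (Z.land m 7, Z.land n 7)
      = (u - quad (m, n)) + quad (q, r) * 8%:R.
    by rewrite {2}Dm {2}Dn !quadE !intZD !intZM (intZ_nat 8); ring.
  by apply: rpredD => //; exact: maxidealMl (quad_integral _) eight_maxideal.
have odd' : Z.odd (Z.add (Z.land m 7) (Z.land n 7)).
  move: odd_mn; rewrite {1}Dm {1}Dn !Z.odd_add !Z.odd_mul /=.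
  by case: Z.odd; case: Z.odd.
have := allP (allP unit_table_correct _ (mem_land7 m)) _ (mem_land7 n).
rewrite odd' /= => /andP[].
have -> : unit_index (unit_table e) (Z.land m 7) (Z.land n 7)
        = unit_index (unit_table e) m n.
  by rewrite /unit_index -!Z.land_assoc.
by move=> j8 same; split=> //; apply: same_unit_class_quad Iu' (unit_rep_neq0 _) same.
Qed.

Definition class_elt l : K := theta^-1 ^+ (l %/ 8) * unit_rep (l %% 8).

Lemma class_eltE k j : (j < 8)%N -> class_elt (8 * k + j) = theta^-1 ^+ k * unit_rep j.
Proof.
by move=> j8; rewrite /class_elt mulnC divnMDl // modnMDl divn_small // addn0 modn_small.
Qed.

Lemma class_index_correct fuel k m n l :
    (k < 6)%N -> class_index e (unit_table e) fuel k m n = Some l ->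
  (l < 48)%N /\ same_class (theta^-1 ^+ k * quad (m, n)) (class_elt l).
Proof.
elim: fuel k m n => //= f IHf k m n k6; case: ifPn => [odd_mn [<-] | even_mn].
  have [|j8 same] := @unit_index_correct (quad (m, n)) m n _ odd_mn.
    by rewrite subrr rpred0.
  split; first by lia.
  by rewrite class_eltE //; apply: same_classM (same_class_refl _) same.
move=> /IHf[|l48]; first by case: (k) k6 => [|[|[|[|[|[]]]]]].
rewrite -quad_even // => same; split=> //; apply: same_class_trans same.
have -> : theta^-1 ^+ k * quad (m, n)
        = theta^-1 ^+ k.+1 * (quad (m, n) * theta).
  by rewrite exprSr; field; rewrite theta_neq0.
apply: same_classM (same_class_refl _).
case: k k6 => [|[|[|[|[|[|//]]]]]] _; try exact: same_class_refl.
(* When k wraps from 5 to 0, the lost factor theta^(-6) is a sixth power. *)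
by exists theta^-1; rewrite ?invr_eq0 ?theta_neq0 // expr0 mul1r.
Qed.

Lemma class_of_correct a l : class_of e (unit_table e) a = Some l ->
  (l < 48)%N /\ same_class (quad a) (class_elt l).
Proof.
rewrite /class_of => /(class_index_correct (isT : 0 < 6)%N).
by rewrite expr0 mul1r -surjective_pairing.
Qed.

(** 1 + t is theta^(-1) times 1 + 2e. When t^2 = -5 this factor is 3, a sixth power because 3 t^6 =
    -375 is congruent to 1 modulo 8. *)
Lemma class_rep_correct l : same_class (quad (class_rep e l)) (class_elt l).
Proof.
rewrite /class_rep /class_elt -/(unit_rep _); elim: (l %/ 8)%N => [|k IHk] /=.
  by rewrite expr0 mul1r; apply: same_class_refl.
rewrite quadM exprS -mulrA; apply: same_classM IHk.
have -> : quad (Zpos 1, Zpos 1) = theta^-1 * (1 + 2%:R * e%:R).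
  by rewrite -theta_norm mulrCA mulVf ?theta_neq0 // mulr1 quadE (intZ_nat 1) mul1r.
rewrite -[X in same_class _ X]mulr1; apply: same_classM (same_class_refl _) _.
have e0 : e = false \/ e = true by case: (e); auto.
case: e0 => De; first by rewrite De mulr0 addr0; apply: same_class_refl.
rewrite -[X in same_class _ X]quad1; apply: (@same_unit_class_quad _ (Zpos 3, Z0)).
- have -> : 1 + 2%:R * e%:R = 3%:R :> K by rewrite De /=; ring.
  by rewrite quadE (intZ_nat 3) (intZ_nat 0) mul0r addr0 subrr rpred0.
- by rewrite quad1 oner_neq0.
by rewrite De; vm_compute.
Qed.

Lemma exists_class x : x != 0 ->
  exists2 l, (l < 48)%N & same_class x (class_elt l).
Proof.
move=> x0; have [c [c0 Oc Oxc]] := integral_multiple x.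
(* Multiplying x by c^6 makes it integral within its class. *)
suff [l l48 same] : exists2 l, (l < 48)%N & same_class (x * c * c ^+ 5) (class_elt l).
  exists l => //; apply: same_class_trans same; apply: same_class_sym.
  by exists c => //; ring.
move: (x * c * c ^+ 5) (mulf_neq0 (mulf_neq0 x0 c0) (expf_neq0 5 c0))
  (rpredM Oxc (rpredX 5 Oc)) => {x c x0 c0 Oc Oxc} x x0 Ox.
have ex_n : exists n, x \notin maxideal n.
  apply: contrapT => no_n; case/eqP: x0; apply: maxideal_separated => n.
  by apply/negP => xn; apply: no_n; exists n; apply/negP.
(* The least power of P that misses x has exponent n + 1, where n is the valuation of x; x theta^n
   is then a unit. *)
have [[|n] xn min_n] := ex_minnP ex_n; first by rewrite maxideal0 Ox in xn.
have Oy : x * theta ^+ n \in integral.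
  rewrite -maxidealE; apply/negP => /negP/min_n; by rewrite ltnn.
have [a [b Dy]] := integralP _ Oy.
(* Three binary digits of each coordinate suffice, as 8 lies in P^5. *)
have [a' Da] := padic_int_digits a 3; have [b' Db] := padic_int_digits b 3.
pose m := Z_of_int (a 3); pose r := Z_of_int (b 3).
have Iy : x * theta ^+ n - quad (m, r) \in maxideal 5.
  have -> : x * theta ^+ n - quad (m, r) = (iota a' + iota b' * t) * 8%:R.
    rewrite Dy quadE /intZ /m /r !Z_of_intK {1}Da {1}Db.
    by rewrite !iotaD !(iotaM (2 ^ 3)%:R) !iota_int (iota_nat (2 ^ 3)); ring.
  have := iota_integral a'; have := iota_integral b'; have := t_integral => Ot Ob Oa.
  apply: maxidealMl; first by solve_integral.
  exact: eight_maxideal.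
have odd_mr : Z.odd (Z.add m r).
  apply/negPn/negP => even_mr; case/negP: xn.
  rewrite -(addn1 n) -maxideal_thetaX -(subrK (quad (m, r)) (_ * _)).
  apply: rpredD; first exact: maxideal_le (isT : 1 <= 5)%N Iy.
  by rewrite maxidealE expr1 quad_even ?quad_integral.
have [j8 same] := unit_index_correct Iy odd_mr; set j := unit_index _ _ _ in j8 same.
exists (8 * (n %% 6) + j)%N; first by have := ltn_pmod n (isT : 0 < 6)%N; lia.
rewrite class_eltE //.
have -> : x = theta^-1 ^+ (n %% 6) * (x * theta ^+ n) * (theta^-1 ^+ (n %/ 6)) ^+ 6.
  rewrite mulrAC -exprM -exprD addnC -divn_eq mulrCA exprVn.
  by rewrite mulVf ?mulr1 // expf_neq0 ?theta_neq0.
apply: same_class_trans (same_classM (same_class_refl _) same).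
by apply: same_class_sixth; rewrite expf_neq0 ?invr_eq0 ?theta_neq0.
Qed.

(** * The upper bound *)

(** Pairing each coefficient with its value turns extending and permuting forms into list
    operations. *)
Definition represents (s : seq K) (b : K) := exists2 p : seq (K * K),
  [seq u.1 | u <- p] = s & \sum_(u <- p) u.1 * u.2 ^+ 6 = b.

Lemma represents_scale s b c : represents s b -> represents s (b * c ^+ 6).
Proof.
case=> p <- <-; exists [seq (u.1, u.2 * c) | u <- p]; first by rewrite -map_comp.
by rewrite big_map mulr_suml; apply: eq_bigr => u _ /=; rewrite exprMn mulrA.
Qed.

Lemma represents0 s : represents s 0.
Proof.
exists [seq (x, 0) | x <- s]; first by rewrite -map_comp map_id.
by rewrite big_map big1 // => x _; rewrite expr0n mulr0.
Qed.

Lemma represents_cons a s b x : represents s b -> represents (a :: s) (a * x ^+ 6 + b).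
Proof. by case=> p <- <-; exists ((a, x) :: p); rewrite //= big_cons. Qed.

Lemma represents_class a a' s b : same_class a a' ->
  represents (a' :: s) b -> represents (a :: s) b.
Proof.
case=> z z0 -> [[|[x y] p] // [-> <-] <-]; rewrite big_cons -/(represents _ _) /=.
have -> : a' * y ^+ 6 = a' * z ^+ 6 * (y / z) ^+ 6 by field.
by apply: represents_cons; exists p.
Qed.

(** Only one inclusion is asked: [D] may miss represented classes, so the trial pairs call for no
    completeness argument. *)
Definition realizes (D : positive) (s : seq K) :=
  forall l, set_mem D l -> represents s (class_elt l).

Lemma trial_powersP k l p : p \in trial_powers e k l ->
  exists X Y, quad p.1 = X ^+ 6 /\ quad p.2 = Y ^+ 6.
Proof.
case/mapP=> q _ ->; exists (quad q.1), (quad q.2).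
by rewrite !quad_exp6E.
Qed.

Definition represents2 (k l i : nat) := exists X Y,
  class_elt i = class_elt k * X ^+ 6 + class_elt l * Y ^+ 6.

Lemma representedP k l g h tr i :
    same_class (quad g) (class_elt k) -> same_class (quad h) (class_elt l) ->
    (forall p, p \in tr -> exists X Y, quad p.1 = X ^+ 6 /\ quad p.2 = Y ^+ 6) ->
    i \in represented e (unit_table e) tr g h ->
  represents2 k l i.
Proof.
move=> [u u0 Dg] [v v0 Dh] trP; rewrite mem_pmap => /mapP[p /trP[X [Y [DX DY]]]].
move=> /esym/class_of_correct[_ [z z0]].
rewrite quadD !quadM DX DY Dg Dh => E; exists (u * X / z), (v * Y / z).
have -> : class_elt i = class_elt i * z ^+ 6 / z ^+ 6 by rewrite mulfK ?expf_neq0.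
by rewrite -E; field.
Qed.

(** Guarantees that the default value 0 in [step_row] never stands for the class of -g_l. *)
Lemma neg_class_defined : all (fun l =>
  isSome (class_of e (unit_table e) (quad_mul e (Zneg 1, Z0) (class_rep e l))))
  (seq.iota 0 48).
Proof. by case: (e); vm_compute. Qed.

Definition table_row l := step_row e (unit_table e) (trial_powers e 0 0)
  (trial_powers e 0 1) (trial_powers e 1 0) (class_reps e) (l, class_rep e l).

Lemma table_row_in l : (l < 48)%N -> table_row l \in step_table e.
Proof.
move=> l48; apply/mapP; exists (l, class_rep e l); rewrite // /class_reps.
by apply/mapP; exists l; rewrite // mem_iota.
Qed.

Lemma table_row_in_take8 l : (l < 8)%N -> table_row l \in take 8 (step_table e).
Proof.
move=> l8; rewrite -map_take; apply/mapP; exists (l, class_rep e l) => //.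
rewrite /class_reps -map_take take_iota.
by apply/mapP; exists l; rewrite // mem_iota.
Qed.

Lemma table_row_neg l : (l < 48)%N ->
  same_class (- class_elt l) (class_elt (table_row l).1).
Proof.
move=> l48; have l_in : l \in seq.iota 0 48 by rewrite mem_iota.
have := allP neg_class_defined l l_in; rewrite /table_row /step_row [_.2]/=.
case E: class_of => [i|] // _; have [_] := class_of_correct E; rewrite [odflt _ _]/=.
have -> : quad (quad_mul e (Zneg 1, Z0) (class_rep e l)) = - quad (class_rep e l).
  by rewrite quadM quadE /intZ /= mul0r addr0 mulN1r.
apply: same_class_trans; have [z z0 ->] := class_rep_correct l.
by apply: same_class_sym; exists z; rewrite // mulNr.
Qed.

Lemma table_row_self l i : set_mem (table_row l).2.1 i -> i = l.
Proof. by move=> /set_mem_of; rewrite inE => /eqP. Qed.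

Lemma table_row_pair k l i : set_mem (nth xH (table_row l).2.2 k) i ->
  represents2 k l i.
Proof.
have [k48 | k48] := ltnP k 48; last first.
  by rewrite nth_default // size_map size_map size_iota.
rewrite (nth_map (0%N, (Zpos 1, Z0))); last by rewrite size_map size_iota.
rewrite /class_reps (nth_map 0%N) ?size_iota // nth_iota // add0n.
move=> /set_mem_of; rewrite !in_cons => /or3P[/eqP-> | /eqP-> |].
- by exists 1, 0; rewrite expr1n expr0n mulr1 mulr0 addr0.
- by exists 0, 1; rewrite expr1n expr0n mulr1 mulr0 add0r.
apply: representedP; [exact: class_rep_correct | exact: class_rep_correct |].
by move=> p; do 2?case: ifP => _; apply: trial_powersP.
Qed.

Lemma realizes_extend D s l a : realizes D s -> same_class a (class_elt l) ->
  realizes (set_bigunion D (table_row l).2.2 (table_row l).2.1) (a :: s).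
Proof.
move=> D_s a_l i /set_mem_bigunion[/table_row_self-> | [k /D_s s_k]].
  apply: represents_class a_l _; rewrite -[X in represents _ X]addr0.
  rewrite -[X in represents _ (X + _)]mulr1 -[X in represents _ (_ * X + _)](expr1n _ 6).
  exact: represents_cons (represents0 s).
case/table_row_pair=> X [Y ->]; apply: represents_class a_l _; rewrite addrC.
exact/represents_cons/represents_scale.
Qed.

(** * Isotropic forms and the induction on the number of variables *)

Definition isotropic (s : seq K) := exists p : seq (K * K),
  [/\ [seq u.1 | u <- p] = s, has (fun u => u.2 != 0) p
    & \sum_(u <- p) u.1 * u.2 ^+ 6 = 0].

Lemma isotropic_extend D s l a : (l < 48)%N -> realizes D s ->
    same_class a (class_elt l) -> set_mem D (table_row l).1 ->
  isotropic (a :: s).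
Proof.
move=> l48 D_s [z z0 Da] /D_s s_neg.
have [v v0 Dv] := table_row_neg l48.
have [p ps sum_p] := represents_scale v s_neg.
(* With the nonzero value z^(-1), [a] contributes [class_elt l], which cancels the value taken by
   [s]. *)
exists ((a, z^-1) :: p); split; rewrite /= ?ps ?invr_eq0 ?z0 //.
by rewrite big_cons sum_p -Dv Da /= exprVn mulfK ?expf_neq0 // subrr.
Qed.

Lemma isotropic_cons a s : isotropic s -> isotropic (a :: s).
Proof.
case=> p [ps p_neq0 sum_p]; exists ((a, 0) :: p).
by split; rewrite /= ?ps ?p_neq0 ?orbT // big_cons sum_p expr0n mulr0 addr0.
Qed.

Lemma isotropic_perm s1 s2 : perm_eq s1 s2 -> isotropic s1 -> isotropic s2.
Proof.
move=> s12 [p [ps p_neq0 sum_p]]; rewrite -ps in s12.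
have /(perm_iotaP 0)[Is perm_Is Ds2] : perm_eq s2 [seq u.1 | u <- p].
  by rewrite perm_sym.
rewrite size_map in perm_Is.
have Dp : perm_eq [seq nth (0, 0) p i | i <- Is] p.
  by rewrite -[X in perm_eq _ X](mkseq_nth (0, 0)) perm_map.
exists [seq nth (0, 0) p i | i <- Is]; split.
- rewrite -map_comp Ds2; apply/eq_in_map => i; rewrite (perm_mem perm_Is) mem_iota.
  by move=> /= ip; rewrite (nth_map (0, 0)).
- by rewrite (perm_has _ Dp).
by rewrite (perm_big _ Dp).
Qed.

Lemma isotropic_scale c s : c != 0 -> isotropic [seq x * c | x <- s] -> isotropic s.
Proof.
move=> c0 [p [ps p_neq0 sum_p]]; exists [seq (u.1 / c, u.2) | u <- p]; split.
- rewrite -map_comp (eq_map (g := (fun x => x / c) \o fst)) // map_comp ps -map_comp.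
  by rewrite -[RHS]map_id; apply: eq_map => x /=; rewrite mulfK.
- by rewrite has_map.
rewrite big_map; under eq_bigr => u _ do rewrite /= mulrAC.
by rewrite -mulr_suml sum_p mul0r.
Qed.

Lemma isotropic0 s : 0 \in s -> isotropic s.
Proof.
move=> s0; apply: isotropic_perm (_ : perm_eq (0 :: rem 0 s) _) _.
  by rewrite perm_sym perm_to_rem.
have [p ps sum_p] := represents0 (rem 0 s).
exists ((0, 1) :: p); split; rewrite /= ?ps ?oner_neq0 //.
by rewrite big_cons sum_p mul0r addr0.
Qed.

(** r_j / r_i equals r_j r_i^5 up to the sixth power r_i^6, and that product has integer
    coordinates. *)
Lemma unit_ratio_class i j : (i < 8)%N -> (j < 8)%N ->
  exists2 l, (l < 8)%N & same_class (unit_rep j / unit_rep i) (unit_rep l).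
Proof.
move=> i8 j8.
pose ri := nth (Zpos 1, Z0) unit_reps i; pose rj := nth (Zpos 1, Z0) unit_reps j.
pose r2 := quad_mul e ri ri.
pose z := quad_mul e rj (quad_mul e ri (quad_mul e r2 r2)).
have odd_z : Z.odd (Z.add z.1 z.2).
  rewrite /z /r2 /ri /rj.
  by case: (e); case: i i8 {ri r2 z} => [|[|[|[|[|[|[|[|//]]]]]]]] _;
     case: j j8 {rj} => [|[|[|[|[|[|[|[|//]]]]]]]] _.
have [|l8 same] := @unit_index_correct (quad z) z.1 z.2 _ odd_z.
  by rewrite -surjective_pairing subrr rpred0.
exists (unit_index (unit_table e) z.1 z.2) => //.
apply: same_class_trans same; exists (unit_rep i)^-1.
  by rewrite invr_eq0 unit_rep_neq0.
rewrite !quadM -/(unit_rep i) -/(unit_rep j); field; exact: unit_rep_neq0.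
Qed.

(** The invariant of the induction on the number of variables. *)
Definition covers (S : PositiveSet.t) (s : seq K) :=
  isotropic s \/ exists2 D, PositiveSet.In D S & realizes D s.

Lemma covers_extend rows S s a l :
    (l < 48)%N -> same_class a (class_elt l) -> table_row l \in rows ->
  covers S s -> covers (extend_sets rows S) (a :: s).
Proof.
move=> l48 a_l l_in [/(isotropic_cons a) | [D S_D D_s]]; first by left.
have [D_neg | D_neg] := boolP (set_mem D (table_row l).1).
  by left; apply: isotropic_extend a_l D_neg.
right; exists (set_bigunion D (table_row l).2.2 (table_row l).2.1).
  exact: extend_sets_correct.
exact: realizes_extend.
Qed.

Lemma perm_repeated_value (T U : eqType) (f : T -> U) (s : seq T) :
  ~~ uniq [seq f x | x <- s] ->
  exists a b r, perm_eq s [:: a, b & r] /\ f a = f b.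
Proof.
elim: s => //= x s IHs; rewrite negb_and negbK => /orP[/mapP[y s_y fxy] | /IHs].
  by exists x, y, (rem y s); rewrite perm_cons perm_to_rem.
case=> a [b [r [s_abr fab]]]; exists a, b, (x :: r); split=> //.
rewrite (perm_trans (y := [:: x, a, b & r])) ?perm_cons //.
exact/permPl/(perm_catCA [:: x] [:: a; b] r).
Qed.

Lemma isotropic7 s : size s = 7 -> isotropic s.
Proof.
move=> s7; have [/isotropic0 // | s0] := boolP (0 \in s).
have s_neq0 x : x \in s -> x != 0 by move=> s_x; apply: contraNneq s0 => <-.
have /choice[cl clP] x : exists l, x != 0 -> (l < 48)%N /\ same_class x (class_elt l).
  have [-> | x0] := eqVneq x 0; first by exists 0%N.
  by have [l] := exists_class x0; exists l.
(* Pigeonhole: seven coefficients have only six possible valuations modulo 6. *)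
have: ~~ uniq [seq (cl x %/ 8)%N | x <- s].
  apply/negP => uniq_lvl.
  have lvl6 : {subset [seq (cl x %/ 8)%N | x <- s] <= seq.iota 0 6}.
    move=> k /mapP[x /s_neq0/clP[x48 _] ->].
    by rewrite mem_iota /= ltn_divLR.
  by have := uniq_leq_size uniq_lvl lvl6; rewrite size_map s7.
case/perm_repeated_value=> a [b [r [s_abr lvl_ab]]].
(* Forms grow at the head, so the pair [a], [b] is put at the end; after division by [a] the list
   ends in b / a, 1. *)
apply: isotropic_perm (_ : perm_eq (rev [:: a, b & r]) s) _.
  by rewrite perm_rev perm_sym.
have in_s x : x \in [:: a, b & r] -> x != 0 by rewrite -(perm_mem s_abr); apply: s_neq0.
have /clP[a48 [u u0 Da]] := in_s a (mem_head _ _).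
have /clP[b48 [v v0 Db]] : b != 0 by apply: in_s; rewrite !inE eqxx orbT.
have lt8 k : (k %% 8 < 8)%N by rewrite ltn_pmod.
have [l l8 ba_l] := unit_ratio_class (lt8 (cl a)) (lt8 (cl b)).
have {}ba_l : same_class (b / a) (class_elt l).
  rewrite -[l](addn0 l) -(muln0 8) addnC class_eltE // expr0 mul1r.
  apply: same_class_trans ba_l; exists (v / u); first by rewrite mulf_neq0 ?invr_eq0.
  rewrite {1}Da {1}Db /class_elt lvl_ab.
  have th0 : theta^-1 ^+ (cl b %/ 8)%N != 0 by rewrite expf_neq0 ?invr_eq0 ?theta_neq0.
  field; by rewrite u0 th0 unit_rep_neq0.
have a0 : a != 0 by apply: in_s; rewrite mem_head.
have : size r = 5 by have := perm_size s_abr; rewrite s7 => -[].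
case: r in_s {s_abr} => [|x1 [|x2 [|x3 [|x4 [|x5 [|//]]]]]] // in_s _.
apply: (isotropic_scale (c := a^-1)); first by rewrite invr_eq0.
rewrite /rev /= mulfV //.
pose S := extend_sets (take 8 (step_table e)) (PositiveSet.singleton (set_of [:: 0%N])).
(* The form with the single coefficient 1 realizes class 0. As b / a has the class of a unit, the
   first eight rows suffice for the next step. *)
have cov2 : covers S [:: b / a; 1].
  apply: (@covers_extend _ _ _ _ l) => //; first by apply: leq_trans l8 _.
    exact: table_row_in_take8.
  right; exists (set_of [:: 0%N]); first exact/PositiveSet.singleton_spec.
  move=> i /set_mem_of; rewrite inE => /eqP->.
  rewrite /class_elt div0n mod0n expr0 mul1r /unit_rep [nth _ _ _]/= quad1.
  exists [:: (1, 1)] => //; by rewrite big_seq1 expr1n mulr1.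
have step T s' x : x \in [:: a; b; x1; x2; x3; x4; x5] -> covers T s' ->
    covers (extend_sets (step_table e) T) (x / a :: s').
  move=> /in_s x0; have xa0 : x / a != 0 by rewrite mulf_neq0 ?invr_eq0.
  have [k k48 x_k] := exists_class xa0.
  exact: covers_extend x_k (table_row_in k48).
have := extend_sets_dies e; rewrite -/S => dies.
have : covers (iter 5 (extend_sets (step_table e)) S)
    [:: x5 / a; x4 / a; x3 / a; x2 / a; x1 / a; b / a; 1].
  do 5![apply: (step); [by rewrite !inE eqxx ?orbT|]].
  exact: cov2.
(* No set is left after five steps, so the isotropic alternative holds. *)
move: dies; move: (iter 5 _ _) => T T0 [|[D T_D _]]; first by [].
by case: ((PositiveSet.is_empty_spec T).1 T0 D T_D).
Qed.

Lemma diagonal_solvable7 (a : 'rV[K]_7) :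
  exists2 x : 'rV[K]_7, x != 0 & \sum_(i < 7) a 0 i * x 0 i ^+ 6 = 0.
Proof.
have [|p [pa p_neq0 sum_p]] := @isotropic7 [seq a 0 i | i <- enum 'I_7].
  by rewrite size_map size_enum_ord.
have size_p : size p = 7 by rewrite -(size_map fst) pa size_map size_enum_ord.
have nth_a (i : 'I_7) : (nth (0, 0) p i).1 = a 0 i.
  rewrite -(nth_map (0, 0) 0 fst) ?size_p // pa (nth_map i) ?size_enum_ord //.
  by rewrite nth_ord_enum.
exists (\row_i (nth (0, 0) p i).2).
  apply: contraTneq p_neq0 => /rowP x0; rewrite -all_predC; apply/(all_nthP (0, 0)).
  move=> i; rewrite size_p => i7; have := x0 (Ordinal i7).
  by rewrite !mxE /= => ->; rewrite eqxx.
rewrite -[RHS]sum_p (big_nth (0, 0)) size_p big_mkord.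
by apply: eq_bigr => i _; rewrite mxE nth_a.
Qed.

End QuadraticExtension.

(** * Both quadratic extensions *)

Lemma diagonal_solvable_leq d r s (K : fieldType) : (0 < d)%N -> (r <= s)%N ->
  diagonal_solvable d r K -> diagonal_solvable d s K.
Proof.
move=> d_gt0 /subnKC <-; move: (s - r)%N => k solv a.
have [x x0 sum_x] := solv (lsubmx a).
exists (row_mx x 0).
  by apply: contraNneq x0 => /(congr1 lsubmx); rewrite row_mxKl linear0 => ->.
rewrite big_split_ord /= [X in _ + X]big1 => [|i _]; last first.
  by rewrite row_mxEr mxE expr0n eqn0Ngt d_gt0 mulr0.
by rewrite addr0 -[RHS]sum_x; apply: eq_bigr => i _; rewrite row_mxEl mxE.
Qed.

(** Horner's scheme: as t^2 = c, (a + b t) t + r = (b c + r) + a t. *)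
Lemma adjoins_sqrt_coords (F : fieldType) (c : F) (L : fieldExtType F) (t x : L) :
  adjoins_sqrt c t -> exists a b : F, x = a%:A + b%:A * t.
Proof.
case=> t2 gen; have: x \in <<1%VS; t>>%VS by rewrite gen memvf.
case/Fadjoin_polyP=> p; elim/poly_ind: p x => [|p q IHp] x p1 ->.
  by exists 0, 0; rewrite horner0 !scale0r mul0r addr0.
have p1' i : (p * 'X + q%:P)`_i \in 1%VS := polyOverP p1 i.
have p_over : p \is a polyOver 1%VS.
  by apply/polyOverP => i; have := p1' i.+1; rewrite coefD coefMX coefC /= addr0.
have [a [b Dp]] := IHp _ p_over erefl.
have := p1' 0%N; rewrite coefD coefMX coefC /= add0r => /vlineP[r ->].
exists (b * c + r), a; rewrite hornerMXaddC Dp mulrDl -mulrA -expr2 t2.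
by rewrite (mulr_algl b) scalerA scalerDl [RHS]addrC addrA.
Qed.

Section SquareRootExtension.
Variables (K : fieldExtType Q2) (c : Q2) (t : K) (e : bool).
Hypothesis t_adj : adjoins_sqrt c t.
Hypothesis c_e : c = - (1 + 4%:R * e%:R).

Let incl : {rmorphism Z2 -> K} := GRing.in_alg K \o @tofrac Z2.

Let incl_inj : injective incl.
Proof.
by move=> x y /(@fmorph_inj _ _ (GRing.in_alg K))/eqP; rewrite tofrac_eq => /eqP.
Qed.

Let t_sqr : t ^+ 2 = - (1 + 4%:R * e%:R).
Proof.
have [-> _] := t_adj.
by rewrite c_e -(in_algE K) rmorphN rmorphD rmorph1 rmorphM !rmorph_nat.
Qed.

Let incl_frac x : exists a b c, c != 0 /\ x * incl c = incl a + incl b * t.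
Proof.
have [y [z ->]] := adjoins_sqrt_coords x t_adj.
have [a [u [u0 Dy]]] := fraction_denominator y.
have [b [v [v0 Dz]]] := fraction_denominator z.
exists (a * v), (b * u), (u * v); split; first exact: mulf_neq0.
rewrite /incl /= !tofracM -Dy -Dz; move: (tofrac u) (tofrac v) => U V.
by rewrite -!(in_algE K) !(rmorphM (GRing.in_alg K)); ring.
Qed.

Lemma Gamma_star6 : [/\ Gamma_star 6 K = 7%N, diagonal_solvable 6 7 K
  & exists a : 'rV[K]_6,
      ~ exists2 x : 'rV[K]_6, x != 0 & \sum_(i < 6) a 0 i * x 0 i ^+ 6 = 0].
Proof.
have solv7 : diagonal_solvable 6 7 K.
  exact: diagonal_solvable7 incl_inj t_sqr incl_frac.
have [a not_a] := not_diagonal_solvable6 incl_inj t_sqr incl_frac.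
split=> //; last by exists a.
(* Solvability for some r below 7 would, after padding with zeros, give solvability in six
   variables. *)
apply/Gamma_starP => //; split=> // r _ solv_r; rewrite leqNgt; apply/negP => r7.
exact/not_a/(diagonal_solvable_leq _ _ solv_r).
Qed.

End SquareRootExtension.

Theorem theorem1 (K : fieldExtType Q2) (t : K)
    (hK : adjoins_sqrt (-1 : Q2) t \/ adjoins_sqrt (- 5%:R : Q2) t) :
  [/\ Gamma_star 6 K = 7%N,
      forall a : 'rV[K]_7,
        exists2 x : 'rV[K]_7, x != 0 & \sum_(i < 7) a 0 i * x 0 i ^+ 6 = 0
    & exists a : 'rV[K]_6,
        ~ exists2 x : 'rV[K]_6, x != 0 & \sum_(i < 6) a 0 i * x 0 i ^+ 6 = 0].
Proof.
case: hK => t_adj.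
  by apply: (@Gamma_star6 K _ t false t_adj); rewrite mulr0 addr0.
by apply: (@Gamma_star6 K _ t true t_adj); rewrite mulr1 nat1r.
Qed.
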